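(* Let $\rho=e^{2\pi i/3}$. For every integer $k\ge0$ and every real $0\le y\le1$, $$\begin{aligned}&\sum_{m\in\mathbb{Z}\setminus\{0\}}\frac{(-1)^m\cos(2m\pi y)}{m^{6k+4}}\left(\frac{\cosh\left((2m\pi i/\rho)(y-1/2)\right)\cosh\left(2m\pi i\rho(y-1/2)\right)}{\sinh\left(m\pi i/\rho\right)^2}\right)\\&\quad=\frac{4(-1)^k(2\pi)^{6k+4}}{3}\sum_{\substack{m_1,m_2,m_3\ge0\\ m_1+m_2+m_3=3k+3}}\frac{B_{2m_1}(y)}{(2m_1)!}\frac{B_{2m_2}(y)}{(2m_2)!}\frac{B_{2m_3}(y)}{(2m_3)!}\rho^{m_2+2m_3}.\end{aligned}$$ In particular, when $y=0$ and $y=\frac12$, the following equations hold: $$\sum_{m\in\mathbb{Z}\setminus\{0\}}\frac{\coth(m\pi i/\rho)^2}{m^{6k+4}}=\frac{4(-1)^k(2\pi)^{6k+4}}{3}\sum_{\substack{m_1,m_2,m_3\ge0\\ m_1+m_2+m_3=3k+3}}\frac{B_{2m_1}(0)}{(2m_1)!}\frac{B_{2m_2}(0)}{(2m_2)!}\frac{B_{2m_3}(0)}{(2m_3)!}\rho^{m_2+2m_3},$$ $$\sum_{m\in\mathbb{Z}\setminus\{0\}}\frac{1}{\sinh(m\pi i/\rho)^2m^{6k+4}}=\frac{4(-1)^k(2\pi)^{6k+4}}{3}\sum_{\substack{m_1,m_2,m_3\ge0\\ m_1+m_2+m_3=3k+3}}\frac{B_{2m_1}(1/2)}{(2m_1)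!}\frac{B_{2m_2}(1/2)}{(2m_2)!}\frac{B_{2m_3}(1/2)}{(2m_3)!}\rho^{m_2+2m_3}.$$
   Context: $B_j(y)$ is the $j$th Bernoulli polynomial: $\dfrac{te^{ty}}{e^t-1}=\sum_{j=0}^\infty B_j(y)\dfrac{t^j}{j!}$. *)

(* Defs.v *)
From mathcomp Require Import all_boot all_order all_algebra finmap complex.
From mathcomp Require Import all_classical all_reals all_analysis.
From mathcomp.analysis.showcase Require Import summability.
From mathcomp Require Import ring lra zify.

Set Implicit Arguments.
Unset Strict Implicit.
Unset Printing Implicit Defensive.

Import Order.TTheory GRing.Theory Num.Theory.
Import numFieldNormedType.Exports.

Local Open Scope complex_scope.
Local Open Scope classical_set_scope.
Local Open Scope ring_scope.

Section ComplexFunctions.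
Variable R : realType.
Implicit Type z : R[i].

Definition cexp z : R[i] :=
  let: a +i* b := z in (expR a * cos b) +i* (expR a * sin b).

Definition ccosh z : R[i] := (cexp z + cexp (- z)) / 2.
Definition csinh z : R[i] := (cexp z - cexp (- z)) / 2.
Definition ccoth z : R[i] := ccosh z / csinh z.

Definition rho : R[i] := cexp (2 * (pi : R)%:C * 'i%C / 3).

End ComplexFunctions.

Arguments rho {R}.

Definition nzint := {m : int | m != 0}.

(* Unconditional convergence, i.e. convergence of the net of partial sums over
   the finite subsets of the index set; R[i]^o carries the topology of the
   modulus. *)
Definition has_sum (R : realType) (I : choiceType) (f : I -> R[i]) (s : R[i]) :
    Prop :=
  (partial_sum f : {fset I} -> R[i]^o) @ totally --> (s : R[i]^o).

(* The generating function has a removable singularity at t = 0, hence the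
   punctured neighbourhood; the identity near 0 determines every (B j).[y]. *)
Definition is_bernoulli (R : realType) (B : nat -> {poly R}) : Prop :=
  forall y : R, \forall t \near 0^',
    pseries (fun j => (B j).[y] / j`!%:R) t @ \oo -->
      t * expR (t * y) / (expR t - 1).

Definition bernoulli_triple_sum (R : realType) (B : nat -> {poly R}) (k : nat)
    (y : R) : R[i] :=
  let b j : R[i] := ((B j).[y] / j`!%:R)%:C in
  \sum_(m1 < (3 * k + 3).+1) \sum_(m2 < (3 * k + 3).+1)
    \sum_(m3 < (3 * k + 3).+1 | (m1 + m2 + m3 == 3 * k + 3)%N)
      b (2 * m1)%N * b (2 * m2)%N * b (2 * m3)%N * rho ^+ (m2 + 2 * m3).

(* The hypothesis is_bernoulli is satisfiable. *)
Section BernoulliExist.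
Variable R : realType.

Fixpoint bern_seq (n : nat) : seq {poly R} :=
  if n is m.+1 then
    let s := bern_seq m in
    rcons s (m`!%:R^-1 *: 'X^m
             - \sum_(0 <= k < m) ((m - k).+1)`!%:R^-1 *: s`_k)
  else [::].

Definition bern_coef n := (bern_seq n.+1)`_n.

Lemma size_bern_seq n : size (bern_seq n) = n.
Proof. by elim: n => //= n IH; rewrite size_rcons IH. Qed.

Lemma nth_bern_seq n k : (k < n)%N -> (bern_seq n)`_k = bern_coef k.
Proof.
elim: n => // n IH; rewrite ltnS leq_eqVlt => /predU1P[-> //|kn].
by rewrite -IH // /= nth_rcons size_bern_seq kn.
Qed.

Lemma bern_coefE n : bern_coef n = n`!%:R^-1 *: 'X^n
  - \sum_(0 <= k < n) ((n - k).+1)`!%:R^-1 *: bern_coef k.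
Proof.
rewrite {1}/bern_coef /= nth_rcons size_bern_seq ltnn eqxx; congr (_ - _).
by apply: eq_big_nat => k /andP[_ kn]; rewrite nth_bern_seq.
Qed.

Lemma bern_coef_rec n y :
  \sum_(0 <= k < n.+1) (bern_coef k).[y] / ((n - k).+1)`!%:R = y ^+ n / n`!%:R.
Proof.
rewrite big_nat_recr //= subnn divr1.
rewrite [in X in _ + X]bern_coefE hornerD hornerN hornerZ hornerXn horner_sum.
under [X in _ + (_ - X)]eq_bigr do rewrite hornerZ mulrC.
by rewrite addrC subrK mulrC.
Qed.

Lemma fact_ge_expn2 j : (2 ^ j <= (j.+1)`!)%N.
Proof. by elim: j => // j IH; rewrite factS expnS leq_mul. Qed.

Lemma fact_inv_le1 j : (j.+1)`!%:R^-1 <= 1 :> R.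
Proof. by rewrite invf_le1 ?ler1n ?ltr0n ?fact_gt0. Qed.

Lemma bern_coef_bound y n : `|(bern_coef n).[y]| <= (2 + 2 * `|y|) ^+ n.
Proof.
set M := _ + _; have y0 : 0 <= `|y| by [].
have M2 : 2 <= M by rewrite lerDl mulr_ge0.
have M0 : 0 <= M by lra.
have geo m : \sum_(0 <= k < m) M ^+ k * 2^-1 ^+ (m - k) <= M ^+ m / 2.
  elim: m => [|m IH]; first by rewrite big_nil expr0; lra.
  rewrite big_nat_recr //= subSnn expr1.
  under eq_big_nat => k /andP[_ km] do
    rewrite subSn ?(ltnW km) // exprSr mulrA.
  rewrite -mulr_suml exprSr.
  have := exprn_ge0 m M0; move: (M ^+ m) IH => x; nra.
elim/ltn_ind: n => -[|n] IH.
  by rewrite bern_coefE big_nil subr0 invr1 scale1r hornerXn !expr0 normr1.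
rewrite bern_coefE hornerD hornerN hornerZ hornerXn horner_sum.
apply: (le_trans (ler_normB _ _)); rewrite (splitr (M ^+ _)); apply: lerD.
  rewrite normrM normrX ger0_norm ?invr_ge0 // mulrC.
  have yM : `|y| ^+ n.+1 <= (M / 2) ^+ n.+1 by apply: lerXn2r; rewrite ?nnegrE //; rewrite /M; lra.
  have h : 2^-1 ^+ n.+1 <= 2^-1 :> R by rewrite exprS ler_piMr ?invr_ge0 // exprn_ile1 ?invr_ge0 // invf_le1 ?ler1n.
  rewrite expr_div_n -exprVn in yM.
  apply: le_trans (_ : M ^+ n.+1 * 2^-1 ^+ n.+1 <= _); last first.
    by rewrite ler_wpM2l // exprn_ge0.
  apply: le_trans yM; rewrite ler_piMr ?exprn_ge0 //.
  exact: fact_inv_le1.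
apply: (le_trans (ler_norm_sum _ _ _)); apply: le_trans (geo n.+1).
apply: ler_sum_nat => k /andP[_ kn].
rewrite hornerZ normrM mulrC [X in _ * X]ger0_norm ?invr_ge0 //.
apply: ler_pM => //; first exact: IH.
rewrite exprVn lef_pV2 ?posrE ?exprn_gt0 ?ltr0n ?fact_gt0 //.
by rewrite -natrX ler_nat fact_ge_expn2.
Qed.

Lemma bern_coef_cvg y t : t != 0 -> `|t| * (2 + 2 * `|y|) <= 8^-1 ->
  pseries (fun k => (bern_coef k).[y]) t @ \oo -->
    t * expR (t * y) / (expR t - 1).
Proof.
set M := _ + _ => t0 tM; have y0 : 0 <= `|y| by [].
have tnn : 0 <= `|t| by [].
have M2 : 2 <= M by rewrite lerDl mulr_ge0.
have t8 : `|t| <= 8^-1 by nra.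
pose b k := (bern_coef k).[y] * t ^+ k.
pose q j := t ^+ j / (j.+1)`!%:R.
have b8 k : `|b k| <= 8^-1 ^+ k.
  rewrite normrM normrX; apply: le_trans (_ : M ^+ k * `|t| ^+ k <= _).
    by rewrite ler_wpM2r ?exprn_ge0 // bern_coef_bound.
  by rewrite -exprMn lerXn2r ?nnegrE ?mulr_ge0 //; [lra|rewrite mulrC].
have q8 j : `|q j| <= 8^-1 ^+ j.
  rewrite normrM normrX [X in _ * X]ger0_norm ?invr_ge0 //.
  apply: le_trans (_ : `|t| ^+ j <= _).
    by rewrite ler_piMr ?exprn_ge0 // fact_inv_le1.
  by rewrite lerXn2r ?nnegrE //; lra.
have h8 : `|8^-1 : R| < 1 by rewrite ger0_norm; lra.
have bc : cvgn (series b).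
  apply: normed_cvg.
  apply: (@series_le_cvg _ _ (geometric 1 8^-1)) => [k|k|k|];
    rewrite /geometric /= ?mul1r ?exprn_ge0 ?b8 ?normr_ge0 //.
  exact: is_cvg_geometric_series.
have E n : series (exp_coeff t) n.+1 = 1 + t * series q n.
  rewrite /series /= big_nat_recl // /exp_coeff /= expr0 fact0 divr1; congr (_ + _).
  by rewrite mulr_sumr; apply: eq_bigr => j _; rewrite /q exprS mulrA.
have qc : series q @ \oo --> (expR t - 1) / t.
  have -> : series q = fun n => (series (exp_coeff t) n.+1 - 1) / t.
    by apply/funext => n; rewrite E addrC addKr mulrC mulKf.
  apply: cvgM; last exact: cvg_cst.
  apply: cvgB; last exact: cvg_cst.
  by rewrite (cvg_shiftS (series (exp_coeff t))); exact: is_cvg_series_exp_coeff.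
have dc : series (exp_coeff (t * y)) @ \oo --> expR (t * y).
  exact: is_cvg_series_exp_coeff.
have D n : series b n * series q n - series (exp_coeff (t * y)) n =
    \sum_(0 <= k < n) \sum_(n - k <= j < n) b k * q j.
  have -> : series (exp_coeff (t * y)) n =
      \sum_(0 <= k < n) \sum_(0 <= j < n - k) b k * q j.
    transitivity (\sum_(0 <= m < n) \sum_(0 <= k < m.+1) b k * q (m - k)%N).
      apply: eq_bigr => m _; rewrite /exp_coeff /= exprMn -mulrA -bern_coef_rec.
      rewrite mulr_sumr !big_nat; apply: eq_bigr => k /andP[_ km].
      have -> : t ^+ m = t ^+ k * t ^+ (m - k) by rewrite -exprD subnKC.
      by rewrite /b /q; ring.
    under eq_big_nat => m /andP[_ mn] do
      rewrite -(subKn mn) (big_nat_widen _ _ n) ?subKn //.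
    rewrite (exchange_big_dep_nat xpredT) //=.
    apply: eq_big_nat => k /andP[_ kn].
    rewrite [RHS](_ : _ = \sum_(0 + k <= m < n) b k * q (m - k)%N); last first.
      by rewrite big_addn; apply: eq_bigr => j _; rewrite addnK.
    rewrite add0n [RHS](big_nat_widenl _ 0%N) //.
  rewrite /series /= mulr_suml -sumrB; apply: eq_big_nat => k /andP[_ kn].
  rewrite mulr_sumr (big_cat_nat (leq0n (n - k)) (leq_subr k n)) /=.
  by rewrite addrAC subrr add0r.
have D0 : (fun n => series b n * series q n - series (exp_coeff (t * y)) n) @ \oo --> 0.
  apply/norm_cvg0P.
  apply: (@squeeze_cvgr _ _ _ _ (fun=> 0) (fun n => 2^-1 ^+ n)).
  - near=> n; rewrite normr_ge0 /= D.
    apply: (le_trans (ler_norm_sum _ _ _)).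
    apply: le_trans (_ : \sum_(0 <= k < n) \sum_(0 <= j < n) 8^-1 ^+ n <= _).
      apply: ler_sum_nat => k /andP[_ kn].
      apply: (le_trans (ler_norm_sum _ _ _)).
      rewrite [leRHS](big_cat_nat (leq0n (n - k)) (leq_subr k n)) /= -[leLHS]add0r.
      apply: lerD; first by apply: sumr_ge0 => *; rewrite exprn_ge0.
      apply: ler_sum_nat => j /andP[kj jn].
      apply: le_trans (_ : 8^-1 ^+ (k + j) <= _).
        by rewrite normrM exprD ler_pM.
      by apply: ler_wiXn2l; [lra|lra|rewrite -leq_subLR].
    rewrite !sumr_const_nat subn0 -!mulrnA -[leLHS]mulr_natr.
    have -> : 8^-1 = 2^-1 * (2^-1 * 2^-1) :> R by field.
    rewrite !exprMn -mulrA ler_piMr ?exprn_ge0 //.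
    rewrite natrM mulrACA -expr2 exprn_ile1 ?mulr_ge0 ?exprn_ge0 //.
    by rewrite exprVn mulrC ler_pdivrMr ?exprn_gt0 // mul1r -natrX ler_nat ltnW // ltn_expl.
  - exact: cvg_cst.
  - by apply: cvg_expr; rewrite ger0_norm; lra.
have lim : limn (series b) * ((expR t - 1) / t) - expR (t * y) = 0.
  apply: (cvg_unique _ _ D0) => //.
  by apply: cvgB => //; apply: cvgM.
have et : expR t - 1 != 0 by rewrite subr_eq0 -expR0 (inj_eq (@expR_inj R)).
suff -> : t * expR (t * y) / (expR t - 1) = limn (series b) by exact: bc.
apply: (mulIf et); rewrite divfK //.
by move/eqP: lim; rewrite subr_eq0 => /eqP <-; field.
Unshelve. all: by end_near.
Qed.

Lemma is_bernoulli_exists : exists B : nat -> {poly R}, is_bernoulli B.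
Proof.
exists (fun n => n`!%:R *: bern_coef n) => y.
have e0 : 0 < (8 * (2 + 2 * `|y|))^-1 by rewrite invr_gt0 mulr_gt0 // ltr_wpDr // mulr_ge0.
near=> t.
rewrite (_ : (fun j => _) = fun j => (bern_coef j).[y]); last first.
  by apply/funext => j; rewrite hornerZ mulrAC mulfV ?mul1r //.
apply: bern_coef_cvg; first by near: t; exact: nbhs_dnbhs_neq.
have : `|t| <= (8 * (2 + 2 * `|y|))^-1 by near: t; apply: dnbhs0_le.
by rewrite invfM -ler_pdivlMr // ltr_wpDr // mulr_ge0.
Unshelve. all: by end_near.
Qed.

End BernoulliExist.

(* Main.v *)
Require Import Defs.
From mathcomp Require Import all_boot all_order all_algebra finmap complex.
From mathcomp Require Import all_classical all_reals all_analysis.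
From mathcomp Require Import ring lra zify.

Set Implicit Arguments.
Unset Strict Implicit.
Unset Printing Implicit Defensive.

Import Order.TTheory GRing.Theory Num.Theory.
Import numFieldNormedType.Exports.
Import ComplexField.Normc.

Local Open Scope complex_scope.
Local Open Scope classical_set_scope.
Local Open Scope ring_scope.

(** Write [a j = cos (2 pi (j + 1) y)].  For [0 <= y <= 1] the even part of
    [t e^(ty) / (e^t - 1)] is [(t / 2) cosh (t (y - 1/2)) / sinh (t / 2)], and
    in the variable [s = t^2 / (4 pi^2)] it has the partial fraction expansion
      [E s = 1 + 2 sum_j a j * s / (s + (j + 1)^2)]
    whose poles are the negated squares.  The triple sum of Bernoulli numbers
    is, up to a power of [2 pi], the coefficient of [s^(3k+3)] in
    [E s * E (rho s) * E (rho^2 s)].  That product has three families of simple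
    poles, permuted by the rotation by [rho], so its partial fraction expansion
    computes the same coefficient as three times a sum over the poles of
    residues; the residue at [-(j+1)^2] is a product of values of [E] at
    [-rho (j+1)^2] and [-rho^2 (j+1)^2], which is the hyperbolic term of the
    series.

    For the truncation of [E] at [N] poles this comparison is an identity between
    rational functions ([triple_residues], [ml_triple_identity]); [N] then tends
    to infinity termwise, under a domination by inverse squares ([tannery]).
    Three facts feed this argument.

    - The truncations converge to the hyperbolic function ([fourier_cosh]).
      This is itself a limit of the exact Fourier inversion of
      [l |-> x^l + x^(n-l)] on the [n]-th roots of unity ([dft_inversion]), with
      [x = e^(t/n)] and [l / n] tending to [y].
    - The Taylor coefficients of the truncations converge to the Bernoulli
      values ([bernoulli_limit]), by comparing both expansions at small [t],
      with error bounds independent of [N].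
    - The residues are dominated by inverse squares ([triple_term_bound]),
      because [Re (- rho) > 0] keeps [- rho (j+1)^2] away from the poles.  The
      same bound turns convergence of the one-sided series into unconditional
      convergence over the nonzero integers ([has_sum_even]). *)

(** * Convergence of sequences, and dominated convergence of series *)

(** A named predicate over an arbitrary field, so that the rules of calculus
    are instantiated at [R[i]] by unifying the field alone and not the
    topologies built on it. *)
Definition tends (K : numFieldType) (u : nat -> K) (l : K) : Prop :=
  u @ \oo --> l.

Section Tends.
Variable K : numFieldType.
Implicit Types (u v : nat -> K) (a b : K).

Lemma tendsP u a : tends u a <->
  forall e, 0 < e -> \forall n \near \oo, `|a - u n| <= e.
Proof. exact: cvgrPdist_le. Qed.

Lemma tends_cst a : tends (fun=> a) a.
Proof. exact: cvg_cst. Qed.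

Lemma tendsD u v a b : tends u a -> tends v b -> tends (fun n => u n + v n) (a + b).
Proof. exact: cvgD. Qed.

Lemma tendsB u v a b : tends u a -> tends v b -> tends (fun n => u n - v n) (a - b).
Proof. exact: cvgB. Qed.

Lemma tendsM u v a b : tends u a -> tends v b -> tends (fun n => u n * v n) (a * b).
Proof. exact: cvgM. Qed.

Lemma tendsV u a : a != 0 -> tends u a -> tends (fun n => (u n)^-1) a^-1.
Proof. by move=> a0; exact: cvgV. Qed.

Lemma tendsX m u a : tends u a -> tends (fun n => u n ^+ m) (a ^+ m).
Proof.
move=> ua; elim: m => [|m IH]; first exact: tends_cst.
by under [X in tends X]eq_fun do rewrite exprS; rewrite exprS; apply: tendsM.
Qed.

Lemma tends_sum (I : Type) (r : seq I) (P : pred I) (u : I -> nat -> K) (a : I -> K) :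
  (forall i, P i -> tends (u i) (a i)) ->
  tends (fun n => \sum_(i <- r | P i) u i n) (\sum_(i <- r | P i) a i).
Proof.
move=> ua; elim: r => [|i r IH].
  by rewrite big_nil; under [X in tends X]eq_fun do rewrite big_nil; exact: tends_cst.
rewrite big_cons; under [X in tends X]eq_fun do rewrite big_cons.
by case: ifP => // Pi; apply: tendsD => //; exact: ua.
Qed.

Lemma tends_near u v a : (\forall n \near \oo, u n = v n) -> tends u a -> tends v a.
Proof. by move=> uv; apply: cvg_trans; apply: near_eq_cvg. Qed.

End Tends.

Section ComplexNorm.
Variable R : realType.
Implicit Types z w : R[i].

Lemma norm_normc z : `|z| = (normc z)%:C.
Proof. by []. Qed.

Lemma normc_ge0 z : 0 <= normc z.
Proof. by rewrite -lecR -norm_normc; exact: normr_ge0. Qed.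

Lemma normcD z w : normc (z + w) <= normc z + normc w.
Proof. exact: le_normcD. Qed.

Lemma normcB z w : normc (z - w) <= normc z + normc w.
Proof. by rewrite -(normcN w); exact: normcD. Qed.

Lemma normc_distC z w : normc (z - w) = normc (w - z).
Proof. by rewrite -normcN opprB. Qed.

Lemma normc_rev z w : normc z - normc w <= normc (z - w).
Proof. by rewrite lerBlDr -{1}(subrK w z) normcD. Qed.

Lemma normc_real (x : R) : normc x%:C = `|x|.
Proof. by rewrite /normc /= expr0n addr0 sqrtr_sqr. Qed.

Lemma normc_nat n : normc (n%:R : R[i]) = n%:R.
Proof. by rewrite -(rmorph_nat (real_complex R)) normc_real normr_nat. Qed.

Lemma normcX z n : normc (z ^+ n) = normc z ^+ n.
Proof. by elim: n => [|n IH]; rewrite ?expr0 ?normc1 // !exprS normcM IH. Qed.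

Lemma normc_sum (I : Type) (r : seq I) (P : pred I) (F : I -> R[i]) :
  normc (\sum_(i <- r | P i) F i) <= \sum_(i <- r | P i) normc (F i).
Proof.
elim/big_ind2: _ => [|x a y b xa yb|//]; first by rewrite normc0.
exact: le_trans (normcD _ _) (lerD xa yb).
Qed.

Lemma Re_le_normc z : complex.Re z <= normc z.
Proof.
case: z => a b; rewrite /normc /=.
apply: le_trans (ler_norm _) _; rewrite -sqrtr_sqr ler_wsqrtr // lerDl sqr_ge0 //.
Qed.

Lemma normc_Re z : `|complex.Re z| <= normc z.
Proof.
case: z => a b; rewrite /normc /= -sqrtr_sqr ler_wsqrtr // lerDl sqr_ge0 //.
Qed.

Lemma tendscP (u : nat -> R[i]) a : tends u a <->
  forall e : R, 0 < e -> \forall n \near \oo, normc (u n - a) <= e.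
Proof.
rewrite tendsP; split=> h e e0.
  have /h : 0 < e%:C :> R[i] by rewrite ltcR.
  by apply: filterS => n; rewrite norm_normc lecR normc_distC.
move: e0; rewrite ltcE /= => /andP[/eqP Ie Re0].
have /h : 0 < complex.Re e by [].
apply: filterS => n hn; rewrite norm_normc normc_distC (complexE e) Ie.
by rewrite mulr0 addr0 lecR.
Qed.

Lemma tends_real (u : nat -> R) a :
  tends (fun n => (u n)%:C) a%:C <-> tends u a.
Proof.
rewrite tendscP tendsP; split=> h e /h; apply: filterS => n;
  by rewrite -rmorphB normc_real distrC.
Qed.

Lemma tends_pair (u v : nat -> R) a b :
  tends u a -> tends v b -> tends (fun n => u n +i* v n) (a +i* b).
Proof.
move=> ua vb; have E x y : x +i* y = x%:C + 'i * y%:C :> R[i] by simpc.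
rewrite E; under [X in tends X]eq_fun do rewrite E.
apply: tendsD; first exact/tends_real.
by apply: tendsM; [exact: tends_cst|exact/tends_real].
Qed.

Lemma tends_normc_le (u : nat -> R[i]) a c :
  tends u a -> (\forall n \near \oo, normc (u n) <= c) -> normc a <= c.
Proof.
move=> /tendscP ua uc; apply/ler_addgt0Pr => e e0.
near \oo => n.
have h1 : normc (u n - a) <= e by near: n; exact: ua.
have h2 : normc (u n) <= c by near: n.
have := normcB (u n) (u n - a); rewrite opprB addrC subrK => h3.
lra.
Unshelve. all: by end_near.
Qed.

Lemma tends_normc_bound (u : nat -> R[i]) a (e : R) : 0 < e -> tends u a ->
  \forall n \near \oo, normc (u n) <= normc a + e.
Proof.
move=> e0 /tendscP /(_ _ e0); apply: filterS => n h.
by have := normcD (u n - a) a; rewrite subrK; lra.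
Qed.

(** By comparison with the telescoping series of general term
    [1 / j - 1 / (j + 1)]. *)
Lemma sum_inv_sqr_le (m n : nat) : (0 < m)%N ->
  \sum_(m <= j < n) (j.+1%:R ^- 2 : R) <= m%:R^-1.
Proof.
move=> m0; have [nm|mn] := leqP n m.
  by rewrite big_geq // invr_ge0 ler0n.
suff : \sum_(m <= j < n) (j.+1%:R ^- 2 : R) <= m%:R^-1 - n%:R^-1.
  by move/le_trans; apply; rewrite lerBlDr lerDl invr_ge0 ler0n.
elim: n mn => // n IH; rewrite ltnS leq_eqVlt => /predU1P[<-|mn].
  rewrite big_nat1; have m1 : 1 <= m%:R :> R by rewrite ler1n.
  rewrite -(natr1 m) -subr_ge0.
  have -> : m%:R^-1 - (m%:R + 1)^-1 - (m%:R + 1) ^- 2 =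
    (m%:R * (m%:R + 1) ^+ 2)^-1 :> R.
    by field; apply/andP; split; lra.
  by rewrite invr_ge0 mulr_ge0 // exprn_ge0 // addr_ge0.
rewrite big_nat_recr /=; last exact: ltnW.
have n1 : 1 <= n%:R :> R by rewrite ler1n (leq_trans _ mn).
have m1 : 1 <= m%:R :> R by rewrite ler1n.
apply: le_trans (lerD (IH mn) (lexx _)) _.
rewrite -(natr1 n) -subr_ge0.
have -> : m%:R^-1 - (n%:R + 1)^-1 - (m%:R^-1 - n%:R^-1 + (n%:R + 1) ^- 2) =
    (n%:R * (n%:R + 1) ^+ 2)^-1 :> R.
  by field; do ?[apply/andP; split]; lra.
by rewrite invr_ge0 mulr_ge0 // exprn_ge0 // addr_ge0.
Qed.

(** Dominated convergence for series: the terms of index at least [J] contribute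
    at most [c / J] to either sum, uniformly in [n], and the finitely many
    others converge. *)
Lemma tannery (a : nat -> nat -> R[i]) (l : nat -> R[i]) (c : R) (J0 : nat) :
  (forall j, tends (a ^~ j) (l j)) ->
  (\forall n \near \oo, forall j, (J0 <= j < n)%N ->
     normc (a n j) <= c * j.+1%:R ^- 2) ->
  tends (fun n => \sum_(0 <= j < n) a n j - \sum_(0 <= j < n) l j) 0.
Proof.
move=> al bnd.
have lb j : (J0 <= j)%N -> normc (l j) <= c * j.+1%:R ^- 2.
  move=> Jj; apply: (tends_normc_le (al j)); near=> n.
  have h : forall j, (J0 <= j < n)%N -> normc (a n j) <= c * j.+1%:R ^- 2.
    by near: n.
  by apply: h; rewrite Jj /=; near: n; exact: nbhs_infty_gt.
have c0 : 0 <= c.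
  have := le_trans (normc_ge0 _) (lb J0 (leqnn _)).
  by rewrite pmulr_lge0 // invr_gt0 exprn_gt0.
apply/tendscP => e e0.
near \oo => J.
have JJ0 : (J0 < J)%N by near: J; exact: nbhs_infty_gt.
have J1 : (0 < J)%N by apply: leq_trans JJ0.
have Je : c * J%:R^-1 <= e / 3.
  rewrite ler_pdivrMr ?ltr0n //.
  near: J; have h0 : 0 < e / 3 by lra.
  near=> J; rewrite mulrC -ler_pdivrMr //.
  near: J; exact: nbhs_infty_ger.
have head : tends (fun n => \sum_(0 <= j < J) (a n j - l j)) 0.
  rewrite [X in tends _ X](_ : _ = \sum_(0 <= j < J) (l j - l j)); last first.
    by rewrite big1 // => i _; rewrite subrr.
  apply: tends_sum => j _; apply: tendsB; [exact: al|exact: tends_cst].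
near=> n.
have Jn : (J <= n)%N by near: n; exact: nbhs_infty_ge.
have hn : normc (\sum_(0 <= j < J) (a n j - l j) - 0) <= e / 3.
  by near: n; move: head => /tendscP; apply; lra.
have bn : forall j, (J0 <= j < n)%N -> normc (a n j) <= c * j.+1%:R ^- 2.
  by near: n.
have tl (f : nat -> R[i]) : (forall j, (J0 <= j < n)%N -> normc (f j) <= c * j.+1%:R ^- 2) ->
    normc (\sum_(J <= j < n) f j) <= e / 3.
  move=> hf; apply: le_trans (normc_sum _ _ _) _.
  apply: le_trans (_ : \sum_(J <= j < n) c * j.+1%:R ^- 2 <= _).
    apply: ler_sum_nat => j /andP[Jj jn]; apply: hf; rewrite jn andbT.
    exact: leq_trans (ltnW JJ0) Jj.
  rewrite -mulr_sumr; apply: (le_trans _ Je).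
  by rewrite ler_wpM2l // sum_inv_sqr_le.
have h1 := tl (a n) bn.
have h2 := tl l (fun j h => lb j (proj1 (andP h))).
rewrite subr0 !(big_cat_nat (leq0n J) Jn) /=.
rewrite subr0 sumrB in hn.
set A := \sum_(0 <= i < J) a n i in hn *; set A' := \sum_(J <= i < n) _ in h1 *.
set B := \sum_(0 <= i < J) l i in hn *; set B' := \sum_(J <= i < n) _ in h2 *.
have -> : A + A' - (B + B') = (A - B) + (A' - B') by ring.
have := normcD (A - B) (A' - B'); have := normcB A' B'; lra.
Unshelve. all: by end_near.
Qed.

End ComplexNorm.

(** * Coefficients of products of partial fractions *)

Section PartialFractions.
Variable F : fieldType.
Implicit Types (f g h : F * seq (F * F)).

(** A pair [(c, zs)] stands for the rational function
    [c + \sum_(z <- zs) z.1 * (z.2 * s / (1 - z.2 * s))], regular at [0] and at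
    infinity; [z.2] is the inverse of a pole.  [pf_coef] gives its Taylor
    coefficients at [0], and [pf_val f q] its value at [s = q^-1]. *)
Definition pf_coef f m :=
  if m is 0 then f.1 else \sum_(z <- f.2) z.1 * z.2 ^+ m.

Definition pf_val f q := f.1 + \sum_(z <- f.2) z.1 * (z.2 / (q - z.2)).

(** Multiplying by [g] changes the weight of a simple pole of [f] by the value of
    [g] there.  When the poles are distinct this is the product of the two
    rational functions, both for Taylor coefficients ([pf_coef_mul]) and for
    values ([pf_val_mul]). *)
Definition pf_mul f g :=
  (f.1 * g.1, [seq (z.1 * pf_val g z.2, z.2) | z <- f.2] ++
              [seq (z.1 * pf_val f z.2, z.2) | z <- g.2]).

Definition pf_disj f g := forall z w, z \in f.2 -> w \in g.2 -> z.2 != w.2.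

Lemma geometric_conv (p q : F) M : p != q ->
  \sum_(i < M) p ^+ i.+1 * q ^+ (M - i) =
    q / (p - q) * p ^+ M.+1 + p / (q - p) * q ^+ M.+1.
Proof.
move=> pq; have pq0 : p - q != 0 by rewrite subr_eq0.
have qp0 : q - p != 0 by rewrite subr_eq0 eq_sym.
elim: M => [|M IH]; first by rewrite big_ord0 !expr1; field; rewrite pq0 qp0.
rewrite big_ord_recr /= subSnn expr1.
under eq_bigr => i _ do rewrite subSn ?(ltnW (ltn_ord i)) // (exprS q) mulrCA.
rewrite -mulr_sumr IH !(exprS _ M.+1).
move: (p ^+ M.+1) (q ^+ M.+1) => a b.
by field; rewrite pq0 qp0.
Qed.

Lemma pf_coefE f m : (0 < m)%N -> pf_coef f m = \sum_(z <- f.2) z.1 * z.2 ^+ m.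
Proof. by case: m. Qed.

Lemma pf_coef_mul f g M : pf_disj f g ->
  \sum_(a < M.+1) pf_coef f a * pf_coef g (M - a) = pf_coef (pf_mul f g) M.
Proof.
move=> dis; case: M => [|M]; first by rewrite big_ord1 subnn.
rewrite big_ord_recl big_ord_recr /= subnn subn0 /bump /=.
under [X in _ + (X + _)]eq_bigr => i _.
  rewrite add1n subSS !pf_coefE ?subn_gt0 // mulr_suml.
  under eq_bigr => z _ do rewrite mulr_sumr.
  over.
rewrite big_cat !big_map /=.
have E : \sum_(i < M) \sum_(z <- f.2) \sum_(w <- g.2)
    z.1 * z.2 ^+ i.+1 * (w.1 * w.2 ^+ (M - i)) =
  \sum_(z <- f.2) \sum_(w <- g.2)
     z.1 * (w.1 * (w.2 / (z.2 - w.2))) * z.2 ^+ M.+1 +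
  \sum_(w <- g.2) \sum_(z <- f.2)
     w.1 * (z.1 * (z.2 / (w.2 - z.2))) * w.2 ^+ M.+1.
  rewrite exchange_big [X in _ = _ + X]exchange_big -big_split /=.
  rewrite big_seq [RHS]big_seq; apply: eq_bigr => z zf.
  rewrite exchange_big -big_split /=.
  rewrite big_seq [RHS]big_seq; apply: eq_bigr => w wg.
  under eq_bigr => i _ do rewrite mulrACA.
  by rewrite -mulr_sumr geometric_conv ?dis //; ring.
rewrite E {E} /pf_val.
have S (x y : seq (F * F)) (c : F) :
  \sum_(z <- x) z.1 * (c + \sum_(w <- y) w.1 * (w.2 / (z.2 - w.2))) * z.2 ^+ M.+1 =
  c * \sum_(z <- x) z.1 * z.2 ^+ M.+1 + \sum_(z <- x) \sum_(w <- y)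
     z.1 * (w.1 * (w.2 / (z.2 - w.2))) * z.2 ^+ M.+1.
  rewrite mulr_sumr -big_split; apply: eq_bigr => z _ /=.
  by rewrite mulrDr mulrDl mulr_sumr mulr_suml; congr (_ + _); ring.
by rewrite !S; ring.
Qed.

Lemma pf_val_mul f g r : pf_disj f g ->
  (forall z, z \in f.2 -> r != z.2) -> (forall z, z \in g.2 -> r != z.2) ->
  pf_val (pf_mul f g) r = pf_val f r * pf_val g r.
Proof.
move=> dis fr gr; rewrite /pf_val /pf_mul /= big_cat !big_map /=.
have S (x y : seq (F * F)) (c : F) :
  \sum_(z <- x) z.1 * (c + \sum_(w <- y) w.1 * (w.2 / (z.2 - w.2))) * (z.2 / (r - z.2)) =
  c * \sum_(z <- x) z.1 * (z.2 / (r - z.2)) + \sum_(z <- x) \sum_(w <- y)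
     z.1 * (w.1 * (w.2 / (z.2 - w.2))) * (z.2 / (r - z.2)).
  rewrite mulr_sumr -big_split; apply: eq_bigr => z _ /=.
  by rewrite mulrDr mulrDl mulr_sumr mulr_suml; congr (_ + _); ring.
rewrite /pf_val !S.
rewrite mulrDl !mulrDr.
have E : (\sum_(z <- f.2) z.1 * (z.2 / (r - z.2))) *
         (\sum_(z <- g.2) z.1 * (z.2 / (r - z.2))) =
  \sum_(z <- f.2) \sum_(w <- g.2)
     z.1 * (w.1 * (w.2 / (z.2 - w.2))) * (z.2 / (r - z.2)) +
  \sum_(w <- g.2) \sum_(z <- f.2)
     w.1 * (z.1 * (z.2 / (w.2 - z.2))) * (w.2 / (r - w.2)).
  rewrite mulr_suml [X in _ = _ + X]exchange_big -big_split /=.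
  rewrite big_seq [RHS]big_seq; apply: eq_bigr => z zf.
  rewrite mulr_sumr -big_split /= big_seq [RHS]big_seq; apply: eq_bigr => w wg.
  have := dis _ _ zf wg; have := fr _ zf; have := gr _ wg.
  case: z w {zf wg} => [c p] [d q] /=.
  rewrite -(subr_eq0 r) -(subr_eq0 r p) -(subr_eq0 p) => h1 h2 h3.
  have h4 : q - p != 0 by rewrite -oppr_eq0 opprB.
  by field; rewrite h1 h2 h3 h4.
by rewrite E; ring.
Qed.

Lemma triple_conv (a b c : nat -> F) M :
  \sum_(m1 < M.+1) \sum_(m2 < M.+1) \sum_(m3 < M.+1 | (m1 + m2 + m3 == M)%N)
    a m1 * b m2 * c m3 =
  \sum_(i < M.+1) a i * \sum_(j < (M - i).+1) b j * c (M - i - j)%N.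
Proof.
apply: eq_bigr => i _; rewrite mulr_sumr.
rewrite (big_ord_widen M.+1 (fun j => a i * (b j * c (M - i - j)%N))) ?ltnS ?leq_subr //.
rewrite big_mkcond [RHS]big_mkcond; apply: eq_bigr => j _ /=.
have iM : (i <= M)%N by rewrite -ltnS.
case: ifP => [|/negbT]; rewrite ltnS.
  move=> jM; have kM : (M - i - j < M.+1)%N by lia.
  rewrite (big_pred1 (Ordinal kM)) ?mulrA //= => k.
  by apply/eqP/eqP => [h|->]; [apply/val_inj => /=; lia|move=> /=; lia].
by rewrite -ltnNge => jM; rewrite big1 // => k /eqP; lia.
Qed.

Lemma triple_pf f g h M :
  pf_disj f g -> pf_disj f h -> pf_disj g h ->
  \sum_(m1 < M.+1) \sum_(m2 < M.+1) \sum_(m3 < M.+1 | (m1 + m2 + m3 == M)%N)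
    pf_coef f m1 * pf_coef g m2 * pf_coef h m3 =
  pf_coef (pf_mul f (pf_mul g h)) M.
Proof.
move=> fg fh gh; rewrite triple_conv -pf_coef_mul.
  by apply: eq_bigr => i _; rewrite pf_coef_mul.
move=> z w zf; rewrite mem_cat => /orP[] /mapP[v vgh ->] /=; [exact: fg|exact: fh].
Qed.

(** Every pole belongs to one factor only, and contributes the product of the
    values of the two other factors there. *)
Lemma triple_residues f g h M :
  pf_disj f g -> pf_disj f h -> pf_disj g h ->
  \sum_(m1 < M.+2) \sum_(m2 < M.+2) \sum_(m3 < M.+2 | (m1 + m2 + m3 == M.+1)%N)
    pf_coef f m1 * pf_coef g m2 * pf_coef h m3 =
  \sum_(z <- f.2) z.1 * (pf_val g z.2 * pf_val h z.2) * z.2 ^+ M.+1 +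
  \sum_(z <- g.2) z.1 * (pf_val f z.2 * pf_val h z.2) * z.2 ^+ M.+1 +
  \sum_(z <- h.2) z.1 * (pf_val f z.2 * pf_val g z.2) * z.2 ^+ M.+1.
Proof.
move=> fg fh gh; rewrite triple_pf //= big_cat map_cat !big_cat !big_map /= addrA.
congr (_ + _ + _).
- rewrite big_seq [RHS]big_seq; apply: eq_bigr => z zf.
  by rewrite pf_val_mul // => w wg; [exact: fg|exact: fh].
- by apply: eq_bigr => z _; ring.
- by apply: eq_bigr => z _; ring.
Qed.

End PartialFractions.

(** * The complex exponential *)

Section ComplexExp.
Variable R : realType.
Implicit Types z w : R[i].

Lemma cexpD z w : cexp (z + w) = cexp z * cexp w.
Proof.
case: z w => a b [c d]; rewrite /cexp /= expRD cosD sinD; simpc.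
by congr (_ +i* _); ring.
Qed.

Lemma cexp0 : cexp (0 : R[i]) = 1.
Proof. by rewrite /cexp /= expR0 cos0 sin0 mulr1 mulr0. Qed.

Lemma cexp_neq0 z : cexp z != 0.
Proof.
apply/eqP => z0; have := cexpD z (- z).
by rewrite subrr cexp0 z0 mul0r => /eqP; rewrite oner_eq0.
Qed.

Lemma cexpN z : cexp (- z) = (cexp z)^-1.
Proof.
by apply: (mulfI (cexp_neq0 z)); rewrite -cexpD subrr cexp0 mulfV ?cexp_neq0.
Qed.

Lemma cexpMn n z : cexp (n%:R * z) = cexp z ^+ n.
Proof.
elim: n => [|n IH]; first by rewrite mul0r cexp0.
by rewrite -natr1 mulrDl mul1r cexpD IH exprSr.
Qed.

Lemma normc_cexp z : normc (cexp z) = expR (complex.Re z).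
Proof.
case: z => a b; rewrite /normc /= !exprMn -mulrDr cos2Dsin2 mulr1.
by rewrite sqrtr_sqr ger0_norm // expR_ge0.
Qed.

Lemma cexp_real (x : R) : cexp x%:C = (expR x)%:C.
Proof. by rewrite /cexp /= cos0 sin0 mulr1 mulr0. Qed.

Lemma cexp_im (x : R) : cexp (0 +i* x) = cos x +i* sin x.
Proof. by rewrite /cexp /= expR0 !mul1r. Qed.

Lemma cexp_imN (x : R) : cexp (- (0 +i* x)) = cos x -i* sin x.
Proof. by rewrite (_ : - _ = 0 +i* (- x)) ?cexp_im ?cosN ?sinN //; simpc. Qed.

Lemma cexp_imD (x : R) : cexp (0 +i* x) + cexp (- (0 +i* x)) = (2 * cos x)%:C.
Proof.
rewrite cexp_im cexp_imN; apply/eqP; rewrite eq_complex /=.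
by apply/andP; split; apply/eqP; ring.
Qed.

Lemma cexp_imB (x : R) : cexp (0 +i* x) - cexp (- (0 +i* x)) = 0 +i* (2 * sin x).
Proof.
rewrite cexp_im cexp_imN; apply/eqP; rewrite eq_complex /=.
by apply/andP; split; apply/eqP; ring.
Qed.

Lemma cexp_neq1 z : complex.Re z != 0 -> cexp z != 1.
Proof.
move=> z0; apply/eqP => /(congr1 (@normc R)); rewrite normc_cexp normc1 -expR0.
by move/expR_inj/eqP; rewrite (negbTE z0).
Qed.

Lemma cexp_2pi : cexp (0 +i* (2 * pi)) = 1 :> R[i].
Proof. by rewrite cexp_im mulr_natl cos2pi sin2pi. Qed.

Lemma cexp_pi : cexp (0 +i* pi) = -1 :> R[i].
Proof. by rewrite cexp_im cospi sinpi; apply/eqP; rewrite eq_complex /= oppr0 !eqxx. Qed.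

Lemma imM (x : R) n : n%:R * (0 +i* x) = 0 +i* (n%:R * x).
Proof. by rewrite -(rmorph_nat (real_complex R)); simpc. Qed.

(** [cos (2 th) = 1] forces [sin th = 0], which fails for [0 < th < pi]. *)
Lemma root_unity_prim n : (0 < n)%N ->
  n.-primitive_root (cexp (0 +i* (2 * pi / n%:R)) : R[i]).
Proof.
set w := cexp _ => n0; apply/andP; split=> //; apply/forallP => -[i /= ilt].
have n0' : (n%:R : R) != 0 by rewrite pnatr_eq0 -lt0n.
rewrite unity_rootE /w -cexpMn imM; apply/eqP; have [->|ne] := eqVneq i.+1 n.
  by rewrite mulrC divfK // cexp_2pi eqxx.
have ltn1 : (i.+1 < n)%N by rewrite ltn_neqAle ne.
apply/eqP; rewrite cexp_im => -[/eqP + _].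
pose th : R := pi * (i.+1%:R / n%:R).
rewrite (_ : _ * _ = th *+ 2); last by rewrite /th; field.
rewrite cos_mulr2n -subr_eq0.
have -> : cos th ^+ 2 *+ 2 - 1 - 1 = - (sin th ^+ 2 *+ 2).
  by rewrite sin2cos2; ring.
rewrite oppr_eq0 mulrn_eq0 /= sqrf_eq0; apply/negP.
rewrite gt_eqF // sin_gt0_pi // /th mulr_gt0 ?pi_gt0 ?divr_gt0 ?ltr0n //=.
by rewrite gtr_pMr ?pi_gt0 // ltr_pdivrMr ?ltr0n // mul1r ltr_nat.
Qed.

Lemma tends_Re (u : nat -> R[i]) a :
  tends u a -> tends (fun n => complex.Re (u n)) (complex.Re a).
Proof.
move=> /tendscP ua; apply/tendsP => e /ua; apply: filterS => n.
by apply: le_trans; rewrite distrC -raddfB; exact: normc_Re.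
Qed.

Lemma tends_Im (u : nat -> R[i]) a :
  tends u a -> tends (fun n => complex.Im (u n)) (complex.Im a).
Proof.
move=> ua; have := tends_Re (tendsM ua (@tends_cst R[i] (- 'i%C))).
have E z : complex.Re (z * - 'i%C) = complex.Im z.
  by case: z => x y /=; rewrite oppr0 mulr0 sub0r mulrN mulr1 opprK.
by rewrite E; under [X in tends X _ -> _]eq_fun do rewrite E.
Qed.

Lemma tends_comp (f : R -> R) (u : nat -> R) a :
  {for a, continuous f} -> tends u a -> tends (fun n => f (u n)) (f a).
Proof. by move=> fa ua; exact: (cvg_comp _ _ ua fa). Qed.

Lemma tends_cexp (u : nat -> R[i]) a : tends u a -> tends (fun n => cexp (u n)) (cexp a).
Proof.
move=> ua; have re := tends_Re ua; have im := tends_Im ua.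
have E z : cexp z = (expR (complex.Re z) * cos (complex.Im z)) +i*
    (expR (complex.Re z) * sin (complex.Im z)) by case: z.
rewrite E; under [X in tends X]eq_fun do rewrite E.
apply: tends_pair; apply: tendsM; apply: tends_comp => //.
- exact: continuous_expR.
- exact: continuous_cos.
- exact: continuous_expR.
- exact: continuous_sin.
Qed.

Lemma tends_quotient (f : R -> R) (df : R) (h : nat -> R) :
  is_derive (0 : R^o) 1 f df -> (forall n, h n != 0) -> tends h 0 ->
  tends (fun n => (f (h n) - f 0) / h n) df.
Proof.
move=> [fd fdf] h0 hh.
have hd : h @ \oo --> 0^'.
  move=> A; rewrite /dnbhs /within /= => /hh; rewrite /nbhs /=.
  by apply: filterS => n; apply; exact: h0.
have fl : (fun k : R => k^-1 *: (f (k *: (1:R^o) + 0) - f 0)) @ 0^' --> df.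
  by rewrite -fdf; exact: fd.
have := cvg_comp _ _ hd fl; apply: cvg_trans; apply: near_eq_cvg.
by near=> n; rewrite /= addr0 /GRing.scale /= mulr1 mulrC.
Unshelve. all: by end_near.
Qed.

(** The real and imaginary parts are difference quotients at the origin of two
    real functions, with derivatives [a] and [b] where [z = a +i* b]. *)
Lemma tends_sinh z (h : nat -> R) : (forall n, h n != 0) -> tends h 0 ->
  tends (fun n => (cexp (z * (h n)%:C) - cexp (- (z * (h n)%:C))) / (2 * (h n)%:C)) z.
Proof.
move=> h0 hh; case: z => a b.
pose f (x : R) := (expR (a * x) - expR (- (a * x))) * cos (b * x) / 2.
pose g (x : R) := (expR (a * x) + expR (- (a * x))) * sin (b * x) / 2.
have E n : (cexp (a +i* b * (h n)%:C) - cexp (- (a +i* b * (h n)%:C))) / (2 * (h n)%:C) =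
    ((f (h n) - f 0) / h n) +i* ((g (h n) - g 0) / h n).
  rewrite /f /g !mulr0 oppr0 sin0 subrr mulr0 !mul0r !subr0.
  have -> : 2 * (h n)%:C = (2 * h n)%:C by rewrite rmorphM rmorph_nat.
  rewrite -fmorphV; simpc.
  by apply/eqP; rewrite eq_complex /= cosN sinN; apply/andP; split;
    apply/eqP; field; exact: h0.
under [X in tends X]eq_fun do rewrite E.
apply: tends_pair; apply: tends_quotient => //.
  apply: is_derive_eq; rewrite !mulr0 oppr0 expR0 cos0 sin0.
  by rewrite /GRing.scale /=; field.
apply: is_derive_eq; rewrite !mulr0 oppr0 expR0 cos0 sin0.
by rewrite /GRing.scale /=; field.
Qed.
End ComplexExp.

(** * A lower bound for the sine *)

Section Jordan.
Variable R : realType.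

(** A weak form of Jordan's inequality: with [u = x / 2] at most [pi / 4],
    [sin x = 2 sin u cos u] and [sin u >= u cos u], while [2 (cos u)^2 >= 1]
    because [cos x >= 0]. *)
Lemma sin_ge_half (x : R) : 0 <= x <= pi / 2 -> x / 2 <= sin x.
Proof.
move=> /andP[x0 xpi]; have p2 := pi_ge2 R.
have hx0 : 0 <= x / 2 by lra.
have [c] := @MVT_segment R sin cos 0 (x / 2) hx0
  (fun y _ => is_derive_sin y) (continuous_subspaceT (@continuous_sin R)).
rewrite sin0 !subr0 in_itv /= => /andP[c0 cx] sE.
have cc : cos (x / 2) <= cos c.
  move: cx; rewrite le_eqVlt => /predU1P[->//|cx].
  by apply/ltW; rewrite ltr_cos // in_itv /=; apply/andP; split; lra.
have c1 : 0 <= cos (x / 2) by apply: cos_ge0_pihalf; apply/andP; split; lra.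
have c2 : 0 <= cos x by apply: cos_ge0_pihalf; apply/andP; split; lra.
have xE : x = (x / 2) *+ 2 by field.
rewrite {2}xE sin_mulr2n sE; rewrite xE cos_mulr2n in c2.
move: (cos c) (cos (x / 2)) cc c1 c2 => u v uv v0 v2.
have uv2 : 1 <= u * v *+ 2.
  have : v ^+ 2 <= u * v by rewrite expr2 ler_wpM2r.
  by move: v2; rewrite !mulr2n; lra.
rewrite (_ : _ *+ 2 = u * v *+ 2 * (x / 2)); last by rewrite !mulr2n; ring.
by rewrite -{1}[x / 2]mul1r ler_wpM2r.
Qed.
End Jordan.

(** * Fourier inversion on the roots of unity *)

(** Truncation of the partial fraction (Mittag-Leffler) expansion in the variable
    [s = t^2 / (4 pi^2)]. *)
Definition ml_sum (F : fieldType) (a : nat -> F) (N : nat) (s : F) : F :=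
  1 + 2 * \sum_(0 <= j < N) a j * (s / (s + j.+1%:R ^+ 2)).

Section DiscreteFourier.
Variable F : fieldType.
Implicit Types x z : F.

(** For [x = e^h] and [z = e^(i th)] this is [sinh h / (cosh h - cos th)], a
    discrete version of [2 t / (t^2 + 4 pi^2 j^2)]. *)
Definition dft_ker x z := (x - x^-1) / (x + x^-1 - z - z^-1).

Lemma dft_ker_inv x z : dft_ker x z^-1 = dft_ker x z.
Proof. by rewrite /dft_ker invrK addrAC. Qed.

(** Two geometric sums of ratios [x * z] and [z / x], whose denominators multiply
    to that of the kernel. *)
Lemma dft_kerE n x z : (0 < n)%N -> z ^+ n = 1 -> x != 0 -> x ^+ n != 1 ->
  dft_ker x z = (\sum_(l < n) (x ^+ l + x ^+ (n - l)) * z ^+ l) / (x ^+ n - 1).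
Proof.
move=> n0 zn x0 xn.
have z0 : z != 0 by apply/eqP => z0; move/eqP: zn; rewrite z0 expr0n eqn0Ngt n0 eq_sym oner_eq0.
have c0 : x ^+ n != 0 by rewrite expf_neq0.
have xz : x * z - 1 != 0.
  by apply: contra_neq xn => /subr0_eq xz; rewrite -[LHS]mulr1 -zn -exprMn xz expr1n.
have zx : z - x != 0 by apply: contra_neq xn => /subr0_eq <-.
have c1 : x ^+ n - 1 != 0 by rewrite subr_eq0.
have -> : \sum_(l < n) (x ^+ l + x ^+ (n - l)) * z ^+ l =
    (\sum_(l < n) (x * z) ^+ l) + x ^+ n * \sum_(l < n) (z / x) ^+ l.
  rewrite mulr_sumr -big_split; apply: eq_bigr => l _ /=.
  rewrite mulrDl exprMn; congr (_ + _).
  have -> : x ^+ n = x ^+ (n - l) * x ^+ l by rewrite -exprD subnK // ltnW.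
  by rewrite expr_div_n; field; rewrite expf_neq0.
have A := subrX1 (x * z) n; rewrite exprMn zn mulr1 in A.
have B := subrX1 (z / x) n; rewrite expr_div_n zn in B.
have zx1 : z / x - 1 != 0.
  by rewrite -(mulfV x0) -mulrBl mulf_neq0 // invr_eq0.
have -> : \sum_(l < n) (x * z) ^+ l = (x ^+ n - 1) / (x * z - 1).
  by rewrite A mulrAC divff // mul1r.
have -> : \sum_(l < n) (z / x) ^+ l = (1 / x ^+ n - 1) / (z / x - 1).
  by rewrite B mulrAC divff // mul1r.
rewrite /dft_ker; move: (x ^+ n) c0 c1 => c c0 c1.
have -> : x + x^-1 - z - z^-1 = (x * z - 1) * (z - x) / (- (x * z)).
  by field; rewrite oppr_eq0 mulf_neq0 // z0 x0.
have -> : z / x - 1 = (z - x) / x by field.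
by field; rewrite c1 x0 zx c0 xz oppr_eq0 mulf_neq0.
Qed.

(** By [dft_kerE] the kernel is a Fourier polynomial in [z], and orthogonality of
    the powers of [zeta] extracts one coefficient. *)
Lemma dft_inversion n zeta x l : n.-primitive_root zeta -> x != 0 -> x ^+ n != 1 ->
  (l <= n)%N ->
  \sum_(j < n) (zeta ^+ j) ^- l * dft_ker x (zeta ^+ j) =
    n%:R * (x ^+ l + x ^+ (n - l)) / (x ^+ n - 1).
Proof.
move=> pz x0 xn; have n0 := prim_order_gt0 pz; have zn := prim_expr_order pz.
have zj j : (zeta ^+ j) ^+ n = 1 by rewrite exprAC zn expr1n.
have z0 : zeta != 0 by rewrite (prim_root_eq0 pz) -lt0n.
wlog ln : l / (l < n)%N => [IH|_].
  (* both sides are unchanged when [l] becomes [n - l] *)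
  rewrite leq_eqVlt => /predU1P[->|ln]; last by apply: IH => //; exact: ltnW.
  rewrite subnn addrC; have := IH 0%N n0 (leq0n _); rewrite subn0 => <-.
  by apply: eq_bigr => j _; rewrite zj expr0.
under eq_bigr => j _ do rewrite (dft_kerE n0) // mulrA mulr_sumr.
rewrite -mulr_suml exchange_big /=; congr (_ / _).
rewrite (bigD1 (Ordinal ln)) //= [X in _ + X]big1 ?addr0.
  under eq_bigr => j _ do
    rewrite mulrCA mulVf ?mulr1 ?expf_neq0 //.
  by rewrite sumr_const card_ord mulr_natl.
move=> k kl.
have E j : (zeta ^+ j) ^- l * (zeta ^+ j) ^+ k = (zeta ^+ k / zeta ^+ l) ^+ j.
  by rewrite exprMn exprVn mulrC !(exprAC zeta j).
under eq_bigr => j _ do rewrite mulrCA E.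
rewrite -mulr_sumr.
set w := _ / _; suff : (w - 1) * \sum_(i < n) w ^+ i == 0.
  rewrite mulf_eq0 => /orP[|/eqP->]; last by rewrite mulr0.
  rewrite subr_eq0 /w => /eqP e1.
  have : zeta ^+ k == zeta ^+ l by rewrite -[zeta ^+ l]mul1r -e1 divfK ?expf_neq0.
  rewrite (eq_prim_root_expr pz) !modn_small // => /eqP kl'.
  by move: kl; rewrite -val_eqE /= kl' eqxx.
by rewrite -subrX1 /w exprMn exprVn !zj invr1 mulr1 subrr.
Qed.

(** Modulo [2 L + 1] the indices [j + 1] and [2 L - j] are opposite, so that the
    kernel takes the same value at the corresponding roots of unity. *)
Lemma sum_odd_fold (f : nat -> F) L :
  \sum_(j < L.*2.+1) f j = f 0%N + \sum_(0 <= j < L) (f j.+1 + f (L.*2 - j)%N).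
Proof.
rewrite big_ord_recl; congr (_ + _); rewrite big_split /=.
rewrite -(big_mkord xpredT (fun j => f j.+1)).
rewrite (@big_cat_nat _ _ _ L) //=; last by rewrite -addnn leq_addr.
congr (_ + _); rewrite -{1}(add0n L) big_addn -addnn addnK big_nat_rev /=.
by rewrite !big_nat; apply: eq_bigr => j jL; congr f; lia.
Qed.

Lemma dft_inversion_odd L zeta x l :
  let n := L.*2.+1 in
  n.-primitive_root zeta -> x != 0 -> x ^+ n != 1 -> (l <= n)%N ->
  dft_ker x 1 + \sum_(0 <= j < L)
      ((zeta ^+ j.+1) ^+ l + (zeta ^+ j.+1) ^- l) * dft_ker x (zeta ^+ j.+1) =
    n%:R * (x ^+ l + x ^+ (n - l)) / (x ^+ n - 1).
Proof.
move=> n pz x0 xn ln; rewrite -(dft_inversion pz) //.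
rewrite (sum_odd_fold (fun j => (zeta ^+ j) ^- l * dft_ker x (zeta ^+ j))).
rewrite expr0 expr1n invr1 mul1r; congr (_ + _).
rewrite !big_nat; apply: eq_bigr => j jL.
have -> : zeta ^+ (L.*2 - j) = (zeta ^+ j.+1)^-1.
  have u : zeta ^+ j.+1 != 0.
    apply: expf_neq0; apply/eqP => z0; have := prim_expr_order pz.
    by rewrite z0 expr0n => /eqP; rewrite eq_sym oner_eq0.
  apply: (mulIf u); rewrite mulVf // -exprD -(prim_expr_order pz) /n.
  by congr (_ ^+ _); lia.
by rewrite dft_ker_inv exprVn invrK -mulrDl addrC.
Qed.

End DiscreteFourier.

(** * The partial fraction expansion of cosh over sinh *)

Section FourierCosh.
Variable R : realType.
Implicit Types (t z w : R[i]) (y : R) (L : nat).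

(** Half of the mesh [1 / (2 L + 1)]: with it the denominator of the kernel at
    [e^(t / (2 L + 1))] is a difference of two squares of [sh_step]. *)
Definition odd_step L : R := (2 * L.*2.+1%:R)^-1.

Lemma odd_step_neq0 L : odd_step L != 0.
Proof. by rewrite invr_eq0 mulf_neq0 // pnatr_eq0. Qed.

Lemma odd_step_inv L : L.*2.+1%:R = (2 * (odd_step L)%:C)^-1 :> R[i].
Proof.
have e : 2 * odd_step L = L.*2.+1%:R^-1 by rewrite /odd_step invfM mulrA mulfV ?mul1r.
rewrite -[2](rmorph_nat (real_complex R)) -rmorphM e fmorphV invrK.
by rewrite rmorph_nat.
Qed.

Lemma tends_inv_odd : tends (fun L => L.*2.+1%:R^-1 : R) 0.
Proof.
apply/tendsP => e e0; near=> L; rewrite sub0r normrN ger0_norm ?invr_ge0 ?ler0n //.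
have hL : e^-1 <= L%:R by near: L; exact: nbhs_infty_ger.
rewrite -[e]invrK lef_pV2 ?posrE ?invr_gt0 ?ltr0n //.
by apply: le_trans hL _; rewrite ler_nat -addnn; lia.
Unshelve. all: by end_near.
Qed.

Lemma tends_odd_step : tends odd_step 0.
Proof.
have := tendsM (@tends_cst R (2^-1)) tends_inv_odd; rewrite mulr0.
by apply: tends_near; near=> L; rewrite /odd_step invfM.
Unshelve. all: by end_near.
Qed.

(** The rescaled hyperbolic sine [2 n sinh (z / (2 n))], with [n = 2 L + 1]. *)
Definition sh_step L z : R[i] :=
  L.*2.+1%:R * (cexp (z * (odd_step L)%:C) - cexp (- (z * (odd_step L)%:C))).

Lemma tends_sh_step z : tends (sh_step ^~ z) z.
Proof.
have := @tends_sinh R z _ odd_step_neq0 tends_odd_step.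
by apply: tends_near; near=> L; rewrite /sh_step odd_step_inv mulrC.
Unshelve. all: by end_near.
Qed.

Lemma dft_ker_step L t w :
  dft_ker (cexp (t * (odd_step L)%:C) ^+ 2) (cexp (w * (odd_step L)%:C) ^+ 2) =
  L.*2.+1%:R * (sh_step L (2 * t) / (sh_step L t ^+ 2 - sh_step L w ^+ 2)).
Proof.
rewrite /sh_step -(mulrA 2 t) !cexpN (cexpMn 2).
have q0 := cexp_neq0 (t * (odd_step L)%:C).
have v0 := cexp_neq0 (w * (odd_step L)%:C).
have n0 : (L.*2.+1%:R : R[i]) != 0 by rewrite pnatr_eq0.
move: (cexp (t * _)) (cexp (w * _)) (L.*2.+1%:R) q0 v0 n0 => q v n q0 v0 n0.
have -> : (n * (q - q^-1)) ^+ 2 - (n * (v - v^-1)) ^+ 2 =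
    n ^+ 2 * (q ^+ 2 + (q ^+ 2)^-1 - v ^+ 2 - (v ^+ 2)^-1).
  by field; rewrite q0 v0.
rewrite /dft_ker; set D := _ + _ - _ - _.
rewrite (invfM (n ^+ 2)); by move: D^-1 => d; field; rewrite n0 q0.
Qed.

(** [dft_inversion_odd] for [x = e^(t/n)], scaled so that every term has a limit
    as [L] grows; the first term tends to the constant [1] of [ml_sum], and the
    [j]-th one to the [j]-th term of [ml_sum]. *)
Lemma dft_step L t l : cexp t != 1 -> (l <= L.*2.+1)%N ->
  t / 2 * (sh_step L (2 * t) / sh_step L t ^+ 2) +
  \sum_(0 <= j < L) t / 2 * ((2 * cos (2 * pi * j.+1%:R * (l%:R / L.*2.+1%:R)))%:C *
     (sh_step L (2 * t) / (sh_step L t ^+ 2 - sh_step L (0 +i* (2 * pi * j.+1%:R)) ^+ 2))) =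
  t / 2 * (cexp (t * (l%:R / L.*2.+1%:R)%:C) +
           cexp (t * (1 - l%:R / L.*2.+1%:R)%:C)) / (cexp t - 1).
Proof.
move=> t1 ln; pose n : R[i] := L.*2.+1%:R.
have n0 : n != 0 by rewrite pnatr_eq0.
have n0R : (L.*2.+1%:R : R) != 0 by rewrite pnatr_eq0.
set x := cexp (t * (odd_step L)%:C) ^+ 2.
have xX k : x ^+ k = cexp (t * (k%:R / L.*2.+1%:R)%:C).
  rewrite /x -exprM -cexpMn mulrCA; congr (cexp (t * _)).
  by rewrite (rmorphM _ k%:R) !fmorphV rmorphM !rmorph_nat natrM -/n; field.
have xn : x ^+ L.*2.+1 = cexp t by rewrite xX divff // mulr1.
have x0 : x != 0 by rewrite expf_neq0 // cexp_neq0.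
have := @dft_inversion_odd R[i] L _ x l (root_unity_prim R (ltn0Sn _)) x0.
set zeta := cexp (0 +i* (2 * pi / L.*2.+1%:R)).
have zX j : zeta ^+ j.+1 = cexp ((0 +i* (2 * pi * j.+1%:R)) * (odd_step L)%:C) ^+ 2.
  rewrite -!cexpMn imM; congr cexp.
  apply/eqP; rewrite eq_complex /odd_step /=; apply/andP; split; apply/eqP; first by ring.
  by field.
have zl j : (zeta ^+ j.+1) ^+ l + (zeta ^+ j.+1) ^- l =
    (2 * cos (2 * pi * j.+1%:R * (l%:R / L.*2.+1%:R)))%:C.
  rewrite -exprM -cexpMn -cexpN imM cexp_imD natrM; congr (2 * cos _)%:C.
  by field.
rewrite xn => /(_ t1 ln) H.
rewrite -[RHS]mulrA -xX.
have -> : cexp (t * (1 - l%:R / L.*2.+1%:R)%:C) = x ^+ (L.*2.+1 - l).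
  by rewrite xX natrB // mulrBl divff.
set S := x ^+ l + _ in H *; set D := cexp t - 1 in H *.
rewrite -[S / D](mulKf n0) (mulrA n) -/n -H {H S D} (mulrDr n^-1) (mulrDr (t / 2)).
congr (_ + _).
  have -> : dft_ker x 1 = dft_ker x (cexp (0 * (odd_step L)%:C) ^+ 2).
    by rewrite mul0r cexp0 expr1n.
  rewrite dft_ker_step mulKf // [sh_step L 0]/sh_step mul0r oppr0 subrr mulr0.
  by rewrite expr0n subr0.
rewrite !mulr_sumr; apply: eq_bigr => j _.
by rewrite zl zX dft_ker_step (mulrCA _ n) mulKf.
Qed.

End FourierCosh.

Section FourierLimit.
Variable R : realType.
Implicit Types (t z w : R[i]) (y : R) (L : nat).

Lemma tends_truncn_div y : 0 <= y <= 1 ->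
  tends (fun L => (Num.truncn (y * L.*2.+1%:R))%:R / L.*2.+1%:R) y.
Proof.
move=> /andP[y0 y1]; apply/tendsP => e e0.
have /tendsP /(_ _ e0) := @tends_inv_odd R; apply: filterS => L.
rewrite sub0r normrN; apply: le_trans.
have n0 : 0 < L.*2.+1%:R :> R by rewrite ltr0n.
have := @truncn_itv R (y * L.*2.+1%:R) (mulr_ge0 y0 (ltW n0)).
set l := Num.truncn _ => /andP[l1 l2].
rewrite -{1}(mulfK (lt0r_neq0 n0) y) -mulrBl normrM ler_piMl //.
by rewrite ler_norml; apply/andP; split; rewrite -natr1 in l2; lra.
Qed.

Lemma truncn_mul_le y n : 0 <= y <= 1 -> (Num.truncn (y * n%:R) <= n)%N.
Proof.
move=> /andP[y0 y1]; rewrite -(@ler_nat R).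
have /andP[h _] := @truncn_itv R (y * n%:R) (mulr_ge0 y0 (ler0n _ _)).
by apply: le_trans h _; rewrite ler_piMl.
Qed.

Lemma sh_step_im_ge L j : (j < L)%N ->
  2 * j.+1%:R <= normc (sh_step L (0 +i* (2 * pi * j.+1%:R)) : R[i]).
Proof.
move=> jL; rewrite /sh_step.
have n0 : 0 < L.*2.+1%:R :> R by rewrite ltr0n.
set th := pi * j.+1%:R / L.*2.+1%:R : R.
have -> : (0 +i* (2 * pi * j.+1%:R)) * (odd_step R L)%:C = 0 +i* th.
  apply/eqP; rewrite eq_complex /= /odd_step /th; apply/andP; split; apply/eqP.
    by ring.
  by field; rewrite gt_eqF.
rewrite cexp_imB normcM normc_nat.
have thI : 0 <= th <= pi / 2.
  rewrite /th divr_ge0 ?mulr_ge0 ?pi_ge0 ?ler0n //=.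
  rewrite -mulrA ler_pM2l ?pi_gt0 // ler_pdivrMr //.
  rewrite -ler_pdivrMl ?invr_gt0 // invrK -natrM ler_nat.
  by rewrite -addnn; lia.
have := sin_ge_half thI; have p2 := pi_ge2 R => h.
have h2 : pi * j.+1%:R = L.*2.+1%:R * th.
  by rewrite /th; field; rewrite gt_eqF.
have -> : normc (0 +i* (2 * sin th)) = 2 * sin th.
  rewrite /normc /= expr0n add0r sqrtr_sqr ger0_norm // mulr_ge0 //.
  by move/andP: thI; lra.
have j0 : 0 <= j.+1%:R :> R by rewrite ler0n.
by nra.
Qed.

Lemma im_sqr (x : R) : (0 +i* x) ^+ 2 = - (x ^+ 2)%:C.
Proof. by rewrite expr2; simpc. Qed.

Lemma sqr_sub_im_neq0 t (x : R) : complex.Re t != 0 -> t ^+ 2 - (0 +i* x) ^+ 2 != 0.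
Proof.
move=> t0; rewrite subr_sqr mulf_neq0 //.
  by apply: contra_neq t0 => /(congr1 (@complex.Re R)); case: t => a b /=; rewrite subr0.
by apply: contra_neq t0 => /(congr1 (@complex.Re R)); case: t => a b /=; rewrite addr0.
Qed.

Lemma normc_cos_le (x : R) : normc (2 * cos x)%:C <= 2.
Proof.
rewrite normc_real normrM ger0_norm //; have := cos_le1 x; have := cos_geN1 x.
by move=> h1 h2; rewrite ler_piMr // ler_norml h1.
Qed.

(** The limit of [dft_step] when [l / n] tends to [y].  The terms are dominated
    because the kernel has denominator at least
    [4 (j + 1)^2 - (|t| + 1)^2] in modulus, which exceeds [2 (j + 1)^2] as soon
    as [j] is large compared with [|t|]. *)
Lemma fourier_cosh t y : complex.Re t != 0 -> 0 <= y <= 1 ->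
  tends (fun L => ml_sum (fun j => (cos (2 * pi * j.+1%:R * y))%:C) L
                    (t ^+ 2 / (4 * pi ^+ 2)%:C))
    (t / 2 * (cexp (t * y%:C) + cexp (t * (1 - y)%:C)) / (cexp t - 1)).
Proof.
move=> Ret y01.
have t1 : cexp t != 1 by exact: cexp_neq1.
have t0 : t != 0 by apply: contra_neq Ret => ->.
pose l L := Num.truncn (y * L.*2.+1%:R).
pose r L : R := (l L)%:R / L.*2.+1%:R.
have ry : tends r y by exact: tends_truncn_div.
pose w (j : nat) : R[i] := 0 +i* (2 * pi * j.+1%:R).
pose a L j : R[i] := t / 2 * ((2 * cos (2 * pi * j.+1%:R * r L))%:C *
   (sh_step L (2 * t) / (sh_step L t ^+ 2 - sh_step L (w j) ^+ 2))).
pose s := t ^+ 2 / (4 * pi ^+ 2)%:C.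
pose b j : R[i] := 2 * ((cos (2 * pi * j.+1%:R * y))%:C * (s / (s + j.+1%:R ^+ 2))).
have ab j : tends (a ^~ j) (b j).
  have -> : b j = t / 2 * ((2 * cos (2 * pi * j.+1%:R * y))%:C *
                      (2 * t / (t ^+ 2 - w j ^+ 2))).
    rewrite /b /s; have := @sqr_sub_im_neq0 t (2 * pi * j.+1%:R) Ret.
    rewrite /w im_sqr !(rmorphM, rmorphXn, rmorph_nat) /=.
    have p0 : (pi : R)%:C != 0 :> R[i].
      by rewrite (inj_eq (@complexI R) _ 0) gt_eqF ?pi_gt0.
    move: (pi%:C) (j.+1%:R) ((cos _)%:C) p0 => p m c p0 h.
    by field; rewrite h p0.
  have S0 z := @tends_sh_step R z.
  apply: tendsM; first exact: tends_cst.
  apply: tendsM.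
    apply/tends_real; apply: tendsM; first exact: tends_cst.
    apply: tends_comp; first exact: continuous_cos.
    by apply: tendsM => //; exact: tends_cst.
  apply: tendsM => //; apply: tendsV; first exact: sqr_sub_im_neq0.
  by apply: tendsB; apply: tendsX.
have [J0 J0P] : exists J0 : nat, (normc t + 1) ^+ 2 <= J0%:R :> R.
  by exists (Num.truncn ((normc t + 1) ^+ 2)).+1; rewrite ltW // truncnS_gt.
have diff0 := @tannery R a b (normc t * (normc (2 * t) + 1) / 2) J0 ab.
have {}diff0 : tends (fun n => \sum_(0 <= j < n) a n j - \sum_(0 <= j < n) b j) 0.
  apply: diff0; near=> L => j /andP[Jj jL].
  have h1 : normc (sh_step L t) <= normc t + 1.
    by near: L; apply: tends_normc_bound => //; exact: tends_sh_step.
  have h2 : normc (sh_step L (2 * t)) <= normc (2 * t) + 1.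
    by near: L; apply: tends_normc_bound => //; exact: tends_sh_step.
  have h3 := sh_step_im_ge jL; rewrite -/(w j) in h3.
  rewrite /a; move: (sh_step L (2 * t)) h2 => U h2.
  rewrite !normcM !normcV (normc_nat _ 2).
  have hc := normc_cos_le (2 * pi * j.+1%:R * r L).
  have hd : 2 * j.+1%:R ^+ 2 <= normc (sh_step L t ^+ 2 - sh_step L (w j) ^+ 2).
    rewrite normc_distC; apply: le_trans (normc_rev _ _).
    rewrite !normcX.
    have := normc_ge0 (sh_step L t); have := normc_ge0 t.
    have : J0%:R <= j.+1%:R :> R by rewrite ler_nat (leq_trans Jj).
    have : 1 <= j.+1%:R :> R by rewrite ler1n.
    move: (normc (sh_step L (w j))) (normc (sh_step L t)) (normc t) h1 h3 J0P.
    move: (j.+1%:R) (J0%:R) => m J u v x h1 h3 hJ h5 h6 h7 h8.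
    have hv : v ^+ 2 <= (x + 1) ^+ 2 by rewrite lerXn2r // nnegrE; lra.
    have hu : (2 * m) ^+ 2 <= u ^+ 2 by rewrite lerXn2r // nnegrE; lra.
    by nra.
  have j0 : 0 < j.+1%:R ^+ 2 :> R by rewrite exprn_gt0 // ltr0n.
  have hi : (normc (sh_step L t ^+ 2 - sh_step L (w j) ^+ 2))^-1 <= (2 * j.+1%:R ^+ 2)^-1.
    by rewrite lef_pV2 // posrE; [apply: lt_le_trans hd|]; rewrite mulr_gt0.
  set D := (normc (_ - _))^-1 in hi *.
  have D0 : 0 <= D by rewrite invr_ge0 normc_ge0.
  have hX : normc (2 * cos (2 * pi * j.+1%:R * r L))%:C *
     (normc U * D) <=
     2 * ((normc (2 * t) + 1) * (2 * j.+1%:R ^+ 2)^-1).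
    apply: ler_pM; rewrite ?mulr_ge0 ?normc_ge0 //.
    by apply: ler_pM; rewrite ?normc_ge0.
  have ht : 0 <= normc t / 2 by rewrite divr_ge0 ?normc_ge0.
  apply: (le_trans (ler_wpM2l ht hX)).
  have jn0 : j.+1%:R != 0 :> R by rewrite pnatr_eq0.
  rewrite le_eqVlt; apply/orP; left; apply/eqP.
  rewrite normcM normc_nat.
  move: (normc t) (j.+1%:R) jn0 => u m m0.
  by field.
have head : tends (fun L => t / 2 * (sh_step L (2 * t) / sh_step L t ^+ 2)) 1.
  rewrite [X in tends _ X](_ : _ = t / 2 * (2 * t / t ^+ 2)); last by field.
  apply: tendsM; first exact: tends_cst.
  apply: tendsM; first exact: tends_sh_step.
  by apply: tendsV; [rewrite expf_neq0|apply: tendsX; exact: tends_sh_step].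
have rhs : tends (fun L => t / 2 * (cexp (t * (r L)%:C) + cexp (t * (1 - r L)%:C)) / (cexp t - 1))
   (t / 2 * (cexp (t * y%:C) + cexp (t * (1 - y)%:C)) / (cexp t - 1)).
  apply: tendsM; last exact: tends_cst.
  apply: tendsM; first exact: tends_cst.
  apply: tendsD; apply: tends_cexp; apply: tendsM; try exact: tends_cst.
    exact/tends_real.
  by apply/tends_real; apply: tendsB => //; exact: tends_cst.
have := tendsD (tendsB (tendsB rhs head) diff0) (@tends_cst R[i] 1).
rewrite subr0 subrK; apply: tends_near; near=> L.
rewrite -dft_step // ?truncn_mul_le // -/(a L _).
rewrite /ml_sum mulr_sumr -/s; set A := _ * (_ / _); set B := \sum_(_ <= _ < _) _.
transitivity (1 + \sum_(0 <= j < L) b j) => //.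
by move: A B => A B; ring.
Unshelve. all: by end_near.
Qed.
End FourierLimit.

(** * Bernoulli polynomials as limits of Fourier sums *)

(** The Taylor coefficients at [0] of [ml_sum a N]. *)
Definition ml_coef (F : fieldType) (a : nat -> F) (N m : nat) : F :=
  if m is 0 then 1
  else - 2 * \sum_(0 <= j < N) a j * (- (j.+1%:R ^- 2)) ^+ m.

Section BernoulliLimit.
Variable R : realType.
Implicit Types (s t y : R).

Lemma tends_norm_le (u : nat -> R) a c :
  tends u a -> (\forall n \near \oo, `|u n| <= c) -> `|a| <= c.
Proof.
move=> /tends_real ua uc; rewrite -normc_real; apply: (tends_normc_le ua).
by apply: filterS uc => n; rewrite normc_real.
Qed.

Lemma sum_inv_sqr_le2 N : \sum_(0 <= j < N) (j.+1%:R ^- 2 : R) <= 2.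
Proof.
case: N => [|N]; first by rewrite big_geq.
rewrite big_nat_recl // expr1n invr1.
have := @sum_inv_sqr_le R 1 N.+1 (ltn0Sn _); rewrite big_add1 /= invr1.
by lra.
Qed.

Lemma geometric_split (u s : R) M : 1 - u * s != 0 ->
  u * s / (1 - u * s) = \sum_(m < M) u ^+ m.+1 * s ^+ m.+1 +
    (u * s) ^+ M.+1 / (1 - u * s).
Proof.
move=> h; elim: M => [|M IH]; first by rewrite big_ord0 expr1 add0r.
rewrite big_ord_recr /= IH -addrA; congr (_ + _).
by rewrite -exprMn (exprS _ M.+1); move: (_ ^+ M.+1) => x; field.
Qed.

(** For [s > 0] the denominators [1 - u s], with [u = - 1 / (j + 1)^2], are at
    least [1], so that the remainder is bounded uniformly in [N]. *)
Lemma ml_sum_expansion (a : nat -> R) N s M : 0 < s -> (forall j, `|a j| <= 1) ->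
  `|ml_sum a N s - \sum_(m < M.+1) ml_coef a N m * s ^+ m| <= 4 * s ^+ M.+1.
Proof.
move=> s0 a1.
pose u j : R := - (j.+1%:R ^- 2).
have J0 j : 0 < j.+1%:R ^+ 2 :> R by rewrite exprn_gt0 // ltr0n.
have us j : 1 <= 1 - u j * s.
  by rewrite /u mulNr opprK lerDl mulr_ge0 ?(ltW s0) // invr_ge0 ltW.
have us0 j : 1 - u j * s != 0 by have := us j; lra.
have -> : ml_sum a N s - \sum_(m < M.+1) ml_coef a N m * s ^+ m =
    - 2 * \sum_(0 <= j < N) a j * ((u j * s) ^+ M.+1 / (1 - u j * s)).
  rewrite big_ord_recl expr0 mulr1 /ml_sum.
  under [X in _ - (_ + X)]eq_bigr => m _ do
    rewrite /= /bump /= add1n -mulrA mulr_suml.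
  rewrite -mulr_sumr exchange_big /=.
  set A := \sum_(0 <= j < N) _; set B := \sum_(0 <= j < N) _; set C := \sum_(0 <= j < N) _.
  suff : A = - B - C by move=> ->; ring.
  rewrite /A /B /C -!sumrN -big_split /=; apply: eq_bigr => j _.
  have -> : s / (s + j.+1%:R ^+ 2) = - (u j * s / (1 - u j * s)).
    rewrite /u; have := us0 j; have := lt0r_neq0 (J0 j); rewrite /u.
    have xs : s + j.+1%:R ^+ 2 != 0 by rewrite gt_eqF // addr_gt0.
    move: (j.+1%:R ^+ 2) xs => x xs x0 h.
    by field; rewrite x0 mulN1r opprK addrC.
  rewrite (geometric_split M (us0 j)) mulrN mulrDr mulr_sumr opprD.
  by congr (- _ - _); apply: eq_bigr => m _; rewrite mulrA.
rewrite normrM normrN (@ger0_norm _ (2 : R)) //.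
suff : `|\sum_(0 <= j < N) a j * ((u j * s) ^+ M.+1 / (1 - u j * s))| <= 2 * s ^+ M.+1.
  move: (`|_|) (s ^+ M.+1) => x z; lra.
apply: le_trans (ler_norm_sum _ _ _) _.
apply: le_trans (_ : \sum_(0 <= j < N) j.+1%:R ^- 2 * s ^+ M.+1 <= _).
  apply: ler_sum => j _; rewrite !normrM normfV (ger0_norm (x := 1 - _)); last by have := us j; lra.
  have sM : 0 <= s ^+ M.+1 by rewrite exprn_ge0 // ltW.
  apply: le_trans (_ : 1 * `|(u j * s) ^+ M.+1| <= _).
    apply: ler_pM; rewrite ?mulr_ge0 ?invr_ge0 //; first by have := us j; lra.
    by rewrite ler_piMr // invf_le1 //; have := us j; lra.
  rewrite mul1r exprMn normrM (ger0_norm sM) ler_wpM2r // normrX /u normrN.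
  rewrite ger0_norm ?invr_ge0 ?(ltW (J0 j)) // exprS ler_piMr ?invr_ge0 ?(ltW (J0 j)) //.
  rewrite exprn_ile1 ?invr_ge0 ?(ltW (J0 j)) // invf_le1 // exprn_ege1 // ler1n //.
by rewrite -mulr_suml ler_wpM2r ?sum_inv_sqr_le2 // exprn_ge0 // ltW.
Qed.

Lemma geometric_tail_le (r : R) d n : 0 <= r <= 2^-1 ->
  \sum_(d <= j < n) r ^+ j <= 2 * r ^+ d.
Proof.
move=> /andP[r0 r2]; have rX k : 0 <= r ^+ k by rewrite exprn_ge0.
have [nd|dn] := leqP n d; first by rewrite big_geq // mulr_ge0.
suff : \sum_(d <= j < n) r ^+ j <= 2 * r ^+ d - 2 * r ^+ n.
  by have := rX n; lra.
elim: n dn => // n IH; rewrite ltnS leq_eqVlt => /predU1P[<-|dn].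
  rewrite big_nat1 exprS; have := rX d; move: (r ^+ d) => x; nra.
rewrite big_nat_recr /=; last exact: ltnW.
have := IH dn; rewrite exprS; have := rX n; move: (r ^+ n) => x; nra.
Qed.

(** The terms of a power series are bounded at some [t0 > 0] where it converges,
    so at half that radius its remainder is dominated by a geometric series. *)
Lemma pseries_truncation (c : nat -> R) (f : R -> R) (d : nat) :
  (\forall t \near 0^', pseries c t @ \oo --> f t) ->
  exists2 r, 0 < r & exists K, forall t, t != 0 -> `|t| < r ->
    `|f t - \sum_(j < d) c j * t ^+ j| <= K * `|t| ^+ d.
Proof.
move=> /nbhs_ballP[e /= e0 he].
have cvt t : t != 0 -> `|t| < e -> pseries c t @ \oo --> f t.
  move=> t0 te; apply: he => //.
  by rewrite /ball /= sub0r normrN.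
pose t0 := e / 2.
have t00 : 0 < t0 by rewrite /t0; lra.
have : bounded_fun (fun i => c i * t0 ^+ i).
  apply: cvg_series_bounded; apply/cvg_ex; exists (f t0).
  by apply: cvt; rewrite ?gt_eqF // ger0_norm /t0; lra.
move=> [K0 [_ /(_ (K0 + 1))]]; rewrite ltrDl ltr01 => /(_ isT) Kb.
set K := K0 + 1 in Kb.
have cb i : `|c i| * t0 ^+ i <= K.
  have := Kb i Logic.I; rewrite /= normrM normrX (ger0_norm (ltW t00)) //.
have K0' : 0 <= K by apply: le_trans (cb 0%N); rewrite mulr_ge0 // exprn_ge0 // ltW.
exists (t0 / 2); first by lra.
exists (2 * K / t0 ^+ d) => t tn0 tr.
have ft : tends (pseries c t) (f t).
  by apply: cvt => //; rewrite /t0 in tr; lra.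
apply: (@tends_norm_le (fun n => pseries c t n - \sum_(j < d) c j * t ^+ j)).
  by apply: tendsB => //; exact: tends_cst.
near=> n.
have dn : (d <= n)%N by near: n; exact: nbhs_infty_ge.
rewrite /pseries /series /= (big_cat_nat (leq0n d) dn) /= big_mkord addrAC subrr add0r.
apply: le_trans (ler_norm_sum _ _ _) _.
have rI : 0 <= `|t| / t0 <= 2^-1.
  by rewrite divr_ge0 ?(ltW t00) //= ler_pdivrMr //; lra.
apply: le_trans (_ : \sum_(d <= j < n) K * (`|t| / t0) ^+ j <= _).
  apply: ler_sum => j _; rewrite normrM normrX expr_div_n.
  have tj : 0 < t0 ^+ j by rewrite exprn_gt0.
  rewrite mulrCA -[leLHS]mulrC ler_wpM2l // ler_pdivlMr //.
rewrite -mulr_sumr; apply: le_trans (ler_wpM2l K0' (geometric_tail_le d n rI)) _.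
rewrite expr_div_n le_eqVlt; apply/orP; left; apply/eqP.
by field; rewrite expf_neq0 // gt_eqF.
Unshelve. all: by end_near.
Qed.

End BernoulliLimit.

Section MlMorph.
Variables (F G : fieldType) (f : {rmorphism F -> G}).

Lemma rmorph_ml_sum (a : nat -> F) N s :
  f (ml_sum a N s) = ml_sum (fun j => f (a j)) N (f s).
Proof.
rewrite /ml_sum rmorphD rmorph1 rmorphM rmorph_nat rmorph_sum; congr (_ + _ * _).
by apply: eq_bigr => j _; rewrite rmorphM fmorph_div rmorphD rmorphXn rmorph_nat.
Qed.

Lemma rmorph_ml_coef (a : nat -> F) N m :
  f (ml_coef a N m) = ml_coef (fun j => f (a j)) N m.
Proof.
case: m => [|m]; first exact: rmorph1.
rewrite /ml_coef rmorphM rmorphN rmorph_nat rmorph_sum; congr (_ * _).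
apply: eq_bigr => j _.
by rewrite rmorphM rmorphXn rmorphN fmorphV rmorphXn rmorph_nat.
Qed.
End MlMorph.

Section BernoulliFourier.
Variable R : realType.
Implicit Types (s t y : R).

(** [(t / 2) cosh (t (y - 1/2)) / sinh (t / 2)]. *)
Definition cosh_gen t y := t / 2 * (expR (t * y) + expR (t * (1 - y))) / (expR t - 1).

Lemma tends_cosh_gen t y : t != 0 -> 0 <= y <= 1 ->
  tends (fun N => ml_sum (fun j => cos (2 * pi * j.+1%:R * y)) N
                    (t ^+ 2 / (4 * pi ^+ 2))) (cosh_gen t y).
Proof.
move=> t0 y01; have := @fourier_cosh R t%:C y t0 y01.
have -> : t%:C / 2 * (cexp (t%:C * y%:C) + cexp (t%:C * (1 - y)%:C)) / (cexp t%:C - 1)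
    = (cosh_gen t y)%:C.
  have ce x : cexp (t%:C * x%:C) = (expR (t * x))%:C by rewrite -rmorphM cexp_real.
  rewrite !ce cexp_real /cosh_gen.
  by rewrite !(rmorphM, rmorphD, rmorphN, fmorphV, rmorph1, rmorph_nat).
move=> h; apply/tends_real; move: h; apply: tends_near; near=> N.
by rewrite (rmorph_ml_sum (real_complex R)) -rmorphXn -fmorph_div.
Unshelve. all: by end_near.
Qed.

Lemma cosh_gen_even t y : t != 0 ->
  t * expR (t * y) / (expR t - 1) + - t * expR (- t * y) / (expR (- t) - 1) =
  2 * cosh_gen t y.
Proof.
move=> t0; have et : expR t != 1 by rewrite -expR0 (inj_eq (@expR_inj R)).
have e0 := lt0r_neq0 (expR_gt0 t); have a0 := lt0r_neq0 (expR_gt0 (t * y)).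
rewrite /cosh_gen.
have -> : expR (t * (1 - y)) = expR t / expR (t * y).
  by rewrite -expRN -expRD; congr expR; ring.
rewrite (mulNr t y) !expRN.
move: (expR t) (expR (t * y)) e0 a0 et => e a e0 a0; rewrite -subr_eq0 => et.
have e1 : 1 - e != 0 by rewrite -oppr_eq0 opprB.
have -> : e^-1 - 1 = (1 - e) / e by field.
by field; rewrite et e0 a0 e1.
Qed.

Lemma even_part_sum (c : nat -> R) t d :
  \sum_(j < (2 * d)%N) c j * t ^+ j + \sum_(j < (2 * d)%N) c j * (- t) ^+ j =
  2 * \sum_(m < d) c (2 * m)%N * t ^+ (2 * m).
Proof.
elim: d => [|d IH]; first by rewrite !big_ord0 mulr0 addr0.
rewrite mulnS !add2n !big_ord_recr /= mulrDr -IH.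
have sgn : (-1) ^+ (2 * d) = 1 :> R by rewrite exprM sqrrN !expr1n.
rewrite (exprNn t (2 * d)) (exprNn t (2 * d).+1) (exprS (-1)) sgn.
by ring.
Qed.

Lemma cosh_gen_expansion (B : nat -> {poly R}) y M : is_bernoulli B ->
  exists2 r, 0 < r & exists2 K, 0 <= K & forall t, 0 < t -> t < r ->
    `|cosh_gen t y - \sum_(m < M.+1) (B (2 * m)%N).[y] / (2 * m)`!%:R * t ^+ (2 * m)|
      <= K * t ^+ (2 * M.+1).
Proof.
move=> hB; set c := fun j => (B j).[y] / j`!%:R.
have [r r0 [K hK]] := pseries_truncation (2 * M.+1) (hB y).
exists r => //; exists `|K| => // t t0 tr.
have tn0 : t != 0 by rewrite gt_eqF.
have h1 := hK t tn0; rewrite gtr0_norm // in h1; have {}h1 := h1 tr.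
have h2 := hK (- t); rewrite oppr_eq0 normrN gtr0_norm // in h2.
have {}h2 := h2 tn0 tr.
have E := cosh_gen_even y tn0; have E2 := even_part_sum c t M.+1.
have hKK : K * t ^+ (2 * M.+1) <= `|K| * t ^+ (2 * M.+1).
  by rewrite ler_wpM2r ?ler_norm // exprn_ge0 // ltW.
rewrite -/c in h1 h2 *.
move: h1 h2 E E2 hKK.
set A1 := _ / _; set A2 := _ / (expR (- t) - 1).
set S1 := \sum_(j < _) _; set S2 := \sum_(j < _) _; set S := \sum_(j < _) _.
move: (cosh_gen t y) => G h1 h2 E E2 hKK.
have -> : G - S = ((A1 - S1) + (A2 - S2)) / 2 by lra.
rewrite normrM (@ger0_norm _ (2^-1)) //.
have := ler_normD (A1 - S1) (A2 - S2); lra.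
Qed.

(** By induction on [m]: at order [m], the expansions of [ml_sum] and of
    [cosh_gen] in powers of [s] agree up to an error [O(s^(m+1))] uniform in [N],
    the error of convergence of [ml_sum] at [s], and the errors on the lower
    coefficients.  After division by [s^m] the first error is small when [s] is,
    and for that fixed [s] the two others vanish as [N] grows. *)
Lemma bernoulli_limit (B : nat -> {poly R}) y m : is_bernoulli B -> 0 <= y <= 1 ->
  tends (fun N => ml_coef (fun j => cos (2 * pi * j.+1%:R * y)) N m)
        ((2 * pi) ^+ (2 * m) * ((B (2 * m)%N).[y] / (2 * m)`!%:R)).
Proof.
move=> hB y01; set a := (fun j : nat => cos (2 * pi * j.+1%:R * y)).
have a1 j : `|a j| <= 1 by rewrite /a ler_norml /= cos_geN1 cos_le1.
pose be m := (2 * pi) ^+ (2 * m) * ((B (2 * m)%N).[y] / (2 * m)`!%:R) : R.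
rewrite -/(be m); elim/ltn_ind: m => M IH.
have [r r0 [K K0 hK]] := cosh_gen_expansion y M hB.
set C := 4 + K * (2 * pi) ^+ (2 * M.+1).
have p2 := pi_ge2 R.
have C4 : 4 <= C by rewrite lerDl mulr_ge0 // exprn_ge0 //; lra.
apply/tendsP => e e0.
(* [t] makes the uniform [O(s)] error at most [e / 2], and is fixed before [N] *)
pose t := Num.min (r / 2) (Num.min 1 (e / (2 * C))).
have [t0 [tr [t1 te]]] : 0 < t /\ (t < r /\ (t <= 1 /\ C * t <= e / 2)).
  have h1 : 0 < e / (2 * C) by rewrite divr_gt0 // mulr_gt0 //; lra.
  split; first by rewrite /t !lt_min h1 ltr01 andbT; lra.
  split; first by rewrite /t gt_min; apply/orP; left; lra.
  split; first by rewrite /t ge_min ge_min lexx !orbT.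
  rewrite mulrC -ler_pdivlMr; last lra.
  apply: le_trans (_ : e / (2 * C) <= _); first by rewrite /t !ge_min lexx !orbT.
  by rewrite le_eqVlt; apply/orP; left; apply/eqP; field; lra.
pose s := t ^+ 2 / (4 * pi ^+ 2).
have tE : t ^+ 2 = (2 * pi) ^+ 2 * s by rewrite /s; field; lra.
have s0 : 0 < s by rewrite divr_gt0 ?exprn_gt0 // mulr_gt0 // exprn_gt0 //; lra.
have st : s <= t.
  have q1 : 1 <= 4 * pi ^+ 2 :> R by nra.
  by rewrite ler_pdivrMr; nra.
have beE k : (B (2 * k)%N).[y] / (2 * k)`!%:R * t ^+ (2 * k) = be k * s ^+ k.
  by rewrite /be !exprM tE exprMn; ring.
have h1 := hK t t0 tr.
rewrite (eq_bigr _ (fun (k : 'I_M.+1) _ => beE k)) in h1.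
have KE : K * t ^+ (2 * M.+1) = K * (2 * pi) ^+ (2 * M.+1) * s ^+ M.+1.
  by rewrite !exprM tE exprMn mulrA.
rewrite KE in h1.
have sM : 0 < s ^+ M by rewrite exprn_gt0.
have e4 : 0 < e / 4 * s ^+ M by rewrite mulr_gt0 //; lra.
have cv := tends_cosh_gen (lt0r_neq0 t0) y01; rewrite -/s -/a in cv.
have low : tends (fun N => \sum_(m < M) (ml_coef a N m - be m) * s ^+ m) 0.
  rewrite [X in tends _ X](_ : _ = \sum_(m < M) (be m - be m) * s ^+ m); last first.
    by rewrite big1 // => m _; rewrite subrr mul0r.
  apply: tends_sum => m _; apply: tendsM; last exact: tends_cst.
  by apply: tendsB; [exact: IH|exact: tends_cst].
near=> N.
have hN1 : `|cosh_gen t y - ml_sum a N s| <= e / 4 * s ^+ M.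
  by near: N; move/tendsP: cv; apply.
have hN2 : `|0 - \sum_(m < M) (ml_coef a N m - be m) * s ^+ m| <= e / 4 * s ^+ M.
  by near: N; move/tendsP: low; apply.
have h2 := ml_sum_expansion N M s0 a1.
rewrite big_ord_recr /= in h1; rewrite big_ord_recr /= in h2.
have E : (be M - ml_coef a N M) * s ^+ M =
  (ml_sum a N s - (\sum_(m < M) ml_coef a N m * s ^+ m + ml_coef a N M * s ^+ M))
  + (cosh_gen t y - ml_sum a N s) 
  - (cosh_gen t y - (\sum_(m < M) be m * s ^+ m + be M * s ^+ M))
  - (0 - \sum_(m < M) (ml_coef a N m - be m) * s ^+ m).
  under [X in _ - (0 - X)]eq_bigr do rewrite mulrBl.
  by rewrite sumrB; ring.
rewrite -(ler_pM2r sM) -{1}(gtr0_norm sM) -normrM E.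
apply: le_trans (_ : 4 * s ^+ M.+1 + e / 4 * s ^+ M +
   K * (2 * pi) ^+ (2 * M.+1) * s ^+ M.+1 + e / 4 * s ^+ M <= _).
  apply: le_trans (ler_normB _ _) (lerD _ hN2).
  apply: le_trans (ler_normB _ _) (lerD _ h1).
  exact: le_trans (ler_normD _ _) (lerD h2 hN1).
have -> : 4 * s ^+ M.+1 + e / 4 * s ^+ M +
   K * (2 * pi) ^+ (2 * M.+1) * s ^+ M.+1 + e / 4 * s ^+ M = 
   (C * s + e / 2) * s ^+ M by rewrite /C exprS; field.
apply: ler_wpM2r; first exact: ltW.
have : C * s <= C * t by rewrite ler_wpM2l //; lra.
lra.
Unshelve. all: by end_near.
Qed.

End BernoulliFourier.

(** * Rotations by the cube root of unity *)

Section Rho.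
Variable R : realType.
Local Notation rho := (@rho R).

Lemma rho_im : rho = cexp (0 +i* (2 * pi / 3)).
Proof.
rewrite /Defs.rho; congr cexp.
have -> : (3 : R[i])^-1 = (3^-1 : R)%:C by rewrite fmorphV rmorph_nat.
rewrite -[2 : R[i]](rmorph_nat (real_complex R)).
by rewrite -rmorphM; simpc.
Qed.

Lemma rho3 : rho ^+ 3 = 1.
Proof.
rewrite rho_im -cexpMn imM -cexp_2pi; congr (cexp (0 +i* _)).
by field.
Qed.

Lemma rho_prim : 3.-primitive_root rho.
Proof. by rewrite rho_im; exact: root_unity_prim. Qed.

Lemma rho_neq1 : rho != 1.
Proof.
by rewrite -(expr1 rho) -(expr0 rho) (eq_prim_root_expr rho_prim).
Qed.

Lemma rho_neq0 : rho != 0.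
Proof. by rewrite rho_im cexp_neq0. Qed.

Lemma rho_sum : 1 + rho + rho ^+ 2 = 0.
Proof.
have h : (rho - 1) * (1 + rho + rho ^+ 2) = 0.
  by transitivity (rho ^+ 3 - 1); [ring|rewrite rho3 subrr].
by apply/eqP; move/eqP: h; rewrite mulf_eq0 subr_eq0 (negbTE rho_neq1).
Qed.

Lemma rhoV : rho^-1 = rho ^+ 2.
Proof. by apply: (mulfI rho_neq0); rewrite mulfV ?rho_neq0 // -exprS rho3. Qed.

Lemma normc_rho : normc rho = 1.
Proof. by rewrite rho_im normc_cexp /= expR0. Qed.

Lemma rho_coord : exists2 b : R, b != 0 &
  rho = (- 2^-1) +i* b /\ rho ^+ 2 = (- 2^-1) +i* (- b).
Proof.
have := rho_sum; have := rho3; have := rho_neq1.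
case: rho => a b ne r3 rs.
have [re im] : 1 + a + (a * a - b * b) = 0 /\ b + (a * b + b * a) = 0.
  move: rs; rewrite expr2; simpc => /eqP; rewrite eq_complex /= => /andP[/eqP h1 /eqP h2].
  by split; [rewrite -[RHS]h1|rewrite -[RHS]h2]; ring.
have b0 : b != 0.
  apply/eqP => b0; rewrite b0 in re.
  by have := sqr_ge0 (a + 2^-1); nra.
have a2 : a = - 2^-1.
  have : b * (1 + 2 * a) = 0 by rewrite -[RHS]im; ring.
  by move/eqP; rewrite mulf_eq0 (negbTE b0) /= => /eqP; lra.
exists b => //; split; first by rewrite a2.
rewrite expr2; simpc; apply/eqP; rewrite eq_complex /=; apply/andP; split; apply/eqP.
  by rewrite a2 in re *; lra.
by rewrite a2; field.
Qed.

End Rho.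

Section RotatedFractions.
Variable R : realType.
Local Notation rho := (@rho R).
Implicit Types (a : nat -> R[i]) (v w : R[i]).

(** The function [s |-> ml_sum a N (w * s)]. *)
Definition ml_pf a N w : R[i] * seq (R[i] * R[i]) :=
  (1, [seq (- 2 * a j, w * - (j.+1%:R ^- 2)) | j <- index_iota 0 N]).

Lemma pf_coef_ml a N w m : pf_coef (ml_pf a N w) m = w ^+ m * ml_coef a N m.
Proof.
case: m => [|m]; first by rewrite mulr1.
rewrite /pf_coef /ml_coef /ml_pf big_map !mulr_sumr; apply: eq_bigr => j _ /=.
by rewrite exprMn; ring.
Qed.

(** The unit complex numbers [w] and [v] are distinct, so the two poles lie on
    different rays from the origin. *)
Lemma pole_neq w v j k : normc w = 1 -> normc v = 1 -> w != v ->
  w * - (j.+1%:R ^- 2) != v * - (k.+1%:R ^- 2).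
Proof.
move=> w1 v1; apply: contra_neq => h.
have := congr1 (@normc R) h; rewrite !normcM w1 v1 !mul1r !normcN !normcV !normcX !normc_nat.
move/invr_inj/eqP; rewrite eqrXn2 // eqr_nat => /eqP jk; move: h; rewrite jk.
by apply: mulIf; rewrite oppr_eq0 invr_eq0 expf_neq0 // pnatr_eq0.
Qed.

Lemma ml_pf_disj a N w v : normc w = 1 -> normc v = 1 -> w != v ->
  pf_disj (ml_pf a N w) (ml_pf a N v).
Proof.
by move=> w1 v1 wv _ _ /mapP[j _ ->] /mapP[k _ ->] /=; exact: pole_neq.
Qed.

Lemma pf_val_ml a N w v k : normc w = 1 -> normc v = 1 -> w != v ->
  pf_val (ml_pf a N w) (v * - (k.+1%:R ^- 2)) = ml_sum a N (- (w / v * k.+1%:R ^+ 2)).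
Proof.
move=> w1 v1 wv; rewrite /pf_val /ml_sum big_map mulr_sumr; congr (_ + _).
apply: eq_bigr => j _ /=.
have v0 : v != 0.
  by apply/eqP => v0; move/eqP: v1; rewrite v0 normc0 eq_sym oner_eq0.
have := @pole_neq v w k j v1 w1; rewrite eq_sym => /(_ wv).
have j0 : (j.+1%:R : R[i]) != 0 by rewrite pnatr_eq0.
have k0 : (k.+1%:R : R[i]) != 0 by rewrite pnatr_eq0.
rewrite -subr_eq0; move: (j.+1%:R) (k.+1%:R) j0 k0 => J K J0 K0 h.
have D : v * J ^+ 2 - w * K ^+ 2 != 0.
  apply: contra_neq h => D.
  have -> : v * - K ^- 2 - w * - J ^- 2 = - (v * J ^+ 2 - w * K ^+ 2) / (J ^+ 2 * K ^+ 2).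
    by field; rewrite J0 K0.
  by rewrite D oppr0 mul0r.
field; rewrite v0 J0 K0 /=; apply/andP; split.
  by rewrite [X in X != 0](_ : _ = v * J ^+ 2 - w * K ^+ 2) //; ring.
by rewrite [X in X != 0](_ : _ = - (v * J ^+ 2 - w * K ^+ 2)) ?oppr_eq0 //; ring.
Qed.

(** The coefficient of [s^(3k+3)] in [E s * E (rho s) * E (rho^2 s)], for the
    truncation [E] of [ml_sum], computed as a Cauchy product and from the
    residues.  The three families of poles contribute equally since the exponent
    is a multiple of [3]. *)
Lemma ml_triple_identity a N k :
  \sum_(m1 < (3 * k + 3).+1) \sum_(m2 < (3 * k + 3).+1)
    \sum_(m3 < (3 * k + 3).+1 | (m1 + m2 + m3 == 3 * k + 3)%N)
      ml_coef a N m1 * ml_coef a N m2 * ml_coef a N m3 * rho ^+ (m2 + 2 * m3) =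
  3 * \sum_(0 <= j < N) - 2 * a j *
     (ml_sum a N (- (rho * j.+1%:R ^+ 2)) * ml_sum a N (- (rho ^+ 2 * j.+1%:R ^+ 2))) *
     (- (j.+1%:R ^- 2)) ^+ (3 * k + 3).
Proof.
have n1 := @normc_rho R; have n0 : normc (1 : R[i]) = 1 by exact: normc1.
have n2 : normc (rho ^+ 2) = 1 by rewrite normcX n1 expr1n.
have r0 := @rho_neq0 R; have r1 := @rho_neq1 R; have r3 := @rho3 R.
have d01 : 1 != rho by rewrite eq_sym.
have d02 : 1 != rho ^+ 2.
  by rewrite eq_sym -rhoV; apply: contra_neq r1 => h; rewrite -[LHS]invrK h invr1.
have d12 : rho != rho ^+ 2.
  by apply: contra_neq d01 => h; apply: (mulfI r0); rewrite mulr1 -expr2.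
have M0 : (3 * k + 3 = (3 * k + 2).+1)%N by lia.
have rM w : w ^+ 3 = 1 -> w ^+ (3 * k + 3) = 1.
  by move=> w3; rewrite exprD exprM w3 expr1n mulr1.
transitivity (\sum_(m1 < (3 * k + 3).+1) \sum_(m2 < (3 * k + 3).+1)
    \sum_(m3 < (3 * k + 3).+1 | (m1 + m2 + m3 == 3 * k + 3)%N)
      pf_coef (ml_pf a N 1) m1 * pf_coef (ml_pf a N rho) m2 *
      pf_coef (ml_pf a N (rho ^+ 2)) m3).
  do 3 (apply: eq_bigr => ? _); rewrite !pf_coef_ml expr1n exprD -exprM.
  by ring.
rewrite M0 triple_residues; [|exact: ml_pf_disj..].
rewrite !big_map /= -M0 -!big_split /= mulr_sumr; apply: eq_bigr => j _.
rewrite !pf_val_ml // 1?eq_sym //.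
have -> : rho / 1 = rho by rewrite divr1.
have -> : rho ^+ 2 / 1 = rho ^+ 2 by rewrite divr1.
have -> : 1 / rho = rho ^+ 2 by rewrite div1r rhoV.
have -> : 1 / rho ^+ 2 = rho by rewrite div1r -rhoV invrK.
have -> : rho ^+ 2 / rho = rho by rewrite expr2 mulfK.
have -> : rho / rho ^+ 2 = rho ^+ 2 by rewrite -[in LHS]rhoV invrK -expr2.
rewrite !(exprMn (3 * k + 3)%N) expr1n (rM rho) //.
by ring.
Qed.

End RotatedFractions.

(** * Passage to the limit in the residue identity *)

Section TripleLimit.
Variable R : realType.
Local Notation rho := (@rho R).
Implicit Types (t w : R[i]) (y : R).

Definition ccosh_gen t y : R[i] :=
  t / 2 * (cexp (t * y%:C) + cexp (t * (1 - y)%:C)) / (cexp t - 1).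

Definition cos_coef y (j : nat) : R[i] := (cos (2 * pi * j.+1%:R * y))%:C.

Lemma cos_coef_le1 y j : normc (cos_coef y j) <= 1.
Proof. by rewrite normc_real ler_norml cos_geN1 cos_le1. Qed.

(** As [Re (- w) = 1/2], adding [(j + 1)^2] to [- w (n + 1)^2] gives a number of
    real part at least [(j + 1)^2]. *)
Lemma ml_sum_rho_bound (a : nat -> R[i]) w N n :
  (forall j, normc (a j) <= 1) -> normc w = 1 -> complex.Re w = - 2^-1 ->
  normc (ml_sum a N (- (w * n.+1%:R ^+ 2))) <= 5 * n.+1%:R ^+ 2.
Proof.
move=> a1 w1 wre; set K : R := n.+1%:R ^+ 2.
have K1 : 1 <= K by rewrite /K exprn_ege1 // ler1n.
apply: le_trans (normcD _ _) _; rewrite normc1 normcM normc_nat.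
suff : normc (\sum_(0 <= j < N) a j * (- (w * n.+1%:R ^+ 2) /
    (- (w * n.+1%:R ^+ 2) + j.+1%:R ^+ 2))) <= 2 * K by lra.
apply: le_trans (normc_sum _ _ _) _.
apply: le_trans (_ : \sum_(0 <= j < N) K * j.+1%:R ^- 2 <= _); last first.
  by rewrite -mulr_sumr mulrC ler_wpM2r ?sum_inv_sqr_le2 //; lra.
apply: ler_sum => j _; rewrite !normcM normcV normcN normcM w1 mul1r normcX normc_nat -/K.
have J0 : 0 < j.+1%:R ^+ 2 :> R by rewrite exprn_gt0 // ltr0n.
have K0 : 0 <= K by lra.
rewrite -[leRHS]mul1r; apply: ler_pM; rewrite ?mulr_ge0 ?invr_ge0 ?normc_ge0 //.
apply: ler_wpM2l => //.
have hd : j.+1%:R ^+ 2 <= normc (- (w * n.+1%:R ^+ 2) + j.+1%:R ^+ 2).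
  apply: le_trans (Re_le_normc _).
  have -> : - (w * n.+1%:R ^+ 2) + j.+1%:R ^+ 2 = (j.+1%:R ^+ 2)%:C - w * K%:C :> R[i].
    by rewrite /K !rmorphXn !rmorph_nat addrC.
  case: w w1 wre => p q /= _ ->; lra.
by rewrite lef_pV2 // posrE; apply: lt_le_trans hd.
Qed.

(** [fourier_cosh] at [t = 2 pi i (n + 1) v], for which
    [t^2 / (4 pi^2) = - w (n + 1)^2]; its real part vanishes only if [v] is real. *)
Lemma tends_ml_sum_rho y n w v : 0 <= y <= 1 -> v ^+ 2 = w -> complex.Im v != 0 ->
  tends (fun N => ml_sum (cos_coef y) N
                     (- (w * n.+1%:R ^+ 2)))
        (ccosh_gen ((0 +i* (2 * pi * n.+1%:R)) * v) y).
Proof.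
move=> y01 vw v0.
have Re0 : complex.Re ((0 +i* (2 * pi * n.+1%:R)) * v) != 0.
  case: v v0 {vw} => p q /= q0; rewrite mul0r sub0r oppr_eq0 mulf_neq0 //.
  by rewrite gt_eqF // !mulr_gt0 ?pi_gt0 ?ltr0n.
have := fourier_cosh Re0 y01.
rewrite exprMn im_sqr vw.
have -> : - ((2 * pi * n.+1%:R) ^+ 2)%:C * w / (4 * pi ^+ 2)%:C = - (w * n.+1%:R ^+ 2).
  have p0 : (pi : R)%:C != 0 :> R[i].
    by rewrite (inj_eq (@complexI R) _ 0) gt_eqF ?pi_gt0.
  rewrite !(rmorphM, rmorphXn, rmorph_nat) /=.
  by move: (pi%:C) p0 => p p0; field.
by [].
Qed.

(** The limit of the [n]-th residue in [ml_triple_identity]. *)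
Definition triple_term k y (n : nat) : R[i] :=
  - 2 * cos_coef y n *
  (ccosh_gen ((0 +i* (2 * pi * n.+1%:R)) * rho ^+ 2) y *
   ccosh_gen ((0 +i* (2 * pi * n.+1%:R)) * rho) y) *
  (- (n.+1%:R ^- 2)) ^+ (3 * k + 3).

(** Each of the two values is at most [5 (n + 1)^2] and the exponent [3 k + 3] is
    at least [3], which leaves [50 / (n + 1)^2]. *)
Lemma triple_term_partial_bound (a : nat -> R[i]) k N n :
  (forall j, normc (a j) <= 1) ->
  normc (- 2 * a n *
     (ml_sum a N (- (rho * n.+1%:R ^+ 2)) * ml_sum a N (- (rho ^+ 2 * n.+1%:R ^+ 2))) *
     (- (n.+1%:R ^- 2)) ^+ (3 * k + 3)) <= 50 * n.+1%:R ^- 2.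
Proof.
move=> a1; have [b b0 [r1 r2]] := rho_coord R.
have n1 := @normc_rho R; have n2 : normc (rho ^+ 2) = 1 by rewrite normcX n1 expr1n.
have h1 := ml_sum_rho_bound N n a1 n1 (congr1 (@complex.Re R) r1).
have h2 := ml_sum_rho_bound N n a1 n2 (congr1 (@complex.Re R) r2).
clear r1 r2.
move: (ml_sum a N _) (ml_sum a N _) h1 h2 => E2 E1 h1 h2.
rewrite !normcM normcN normc_nat normcX normcN normcV normcX normc_nat.
set K : R := n.+1%:R ^+ 2 in h1 h2 *.
have K1 : 1 <= K by rewrite /K exprn_ege1 // ler1n.
have hK : K^-1 ^+ (3 * k + 3) <= K^-1 ^+ 3.
  apply: ler_wiXn2l; [by rewrite invr_ge0; lra|by rewrite invf_le1; lra|lia].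
apply: le_trans (_ : 2 * 1 * (5 * K * (5 * K)) * K^-1 ^+ 3 <= _); last first.
  by rewrite le_eqVlt; apply/orP; left; apply/eqP; field; lra.
apply: ler_pM => //; rewrite ?mulr_ge0 ?normc_ge0 ?exprn_ge0 ?invr_ge0 //; first lra.
apply: ler_pM => //; rewrite ?mulr_ge0 ?normc_ge0 //.
  by rewrite ler_wpM2l.
by apply: ler_pM; rewrite ?normc_ge0.
Qed.

Lemma tends_triple_term_partial k y n : 0 <= y <= 1 ->
  tends (fun N => - 2 * cos_coef y n *
     (ml_sum (cos_coef y) N (- (rho * n.+1%:R ^+ 2)) *
      ml_sum (cos_coef y) N (- (rho ^+ 2 * n.+1%:R ^+ 2))) *
     (- (n.+1%:R ^- 2)) ^+ (3 * k + 3)) (triple_term k y n).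
Proof.
move=> y01; have [b b0 [r1 r2]] := rho_coord R.
apply: tendsM; last exact: tends_cst.
apply: tendsM; first exact: tends_cst.
apply: tendsM; apply: tends_ml_sum_rho => //.
- by rewrite -exprM (exprD _ 3 1) rho3 mul1r.
- by rewrite r2 /= oppr_eq0.
- by rewrite r1.
Qed.

Lemma triple_term_bound k y n : 0 <= y <= 1 ->
  normc (triple_term k y n) <= 50 * n.+1%:R ^- 2.
Proof.
move=> y01; apply: (tends_normc_le (@tends_triple_term_partial k y n y01)).
near=> N; apply: triple_term_partial_bound => j; exact: cos_coef_le1.
Unshelve. all: by end_near.
Qed.

Lemma tends_triple_sum (B : nat -> {poly R}) k y : is_bernoulli B -> 0 <= y <= 1 ->
  tends (fun N => \sum_(0 <= n < N) triple_term k y n)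
    ((2 * (pi : R)%:C) ^+ (6 * k + 6) * bernoulli_triple_sum B k y / 3).
Proof.
move=> hB y01; set a := cos_coef y.
pose T N n := - 2 * a n *
     (ml_sum a N (- (rho * n.+1%:R ^+ 2)) * ml_sum a N (- (rho ^+ 2 * n.+1%:R ^+ 2))) *
     (- (n.+1%:R ^- 2)) ^+ (3 * k + 3).
have diff0 : tends (fun N => \sum_(0 <= n < N) T N n - \sum_(0 <= n < N) triple_term k y n) 0.
  apply: (@tannery R _ _ 50 0) => [n|]; first exact: tends_triple_term_partial.
  near=> N => n _; apply: triple_term_partial_bound => j; exact: cos_coef_le1.
pose be m : R[i] := (2 * (pi : R)%:C) ^+ (2 * m) * ((B (2 * m)%N).[y] / (2 * m)`!%:R)%:C.
have cbe m : tends (fun N => ml_coef a N m) (be m).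
  have := @bernoulli_limit R B y m hB y01 => /tends_real.
  rewrite /be rmorphM rmorphXn rmorphM rmorph_nat.
  by apply: tends_near; near=> N; rewrite (rmorph_ml_coef (real_complex R)).
pose S N := \sum_(m1 < (3 * k + 3).+1) \sum_(m2 < (3 * k + 3).+1)
    \sum_(m3 < (3 * k + 3).+1 | (m1 + m2 + m3 == 3 * k + 3)%N)
      ml_coef a N m1 * ml_coef a N m2 * ml_coef a N m3 * rho ^+ (m2 + 2 * m3).
have Slim : tends S ((2 * (pi : R)%:C) ^+ (6 * k + 6) * bernoulli_triple_sum B k y).
  have -> : (2 * (pi : R)%:C) ^+ (6 * k + 6) * bernoulli_triple_sum B k y =
    \sum_(m1 < (3 * k + 3).+1) \sum_(m2 < (3 * k + 3).+1)
    \sum_(m3 < (3 * k + 3).+1 | (m1 + m2 + m3 == 3 * k + 3)%N)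
      be m1 * be m2 * be m3 * rho ^+ (m2 + 2 * m3).
    rewrite /bernoulli_triple_sum mulr_sumr; apply: eq_bigr => m1 _.
    rewrite mulr_sumr; apply: eq_bigr => m2 _.
    rewrite mulr_sumr; apply: eq_bigr => m3 /eqP m123.
    have -> : (6 * k + 6 = 2 * m1 + 2 * m2 + 2 * m3)%N by lia.
    rewrite 2!(exprD (2 * pi%:C)) /be.
    move: (_ ^+ (2 * m1)) (_ ^+ (2 * m2)) (_ ^+ (2 * m3)) (rho ^+ _).
    by move=> p1 p2 p3 r; ring.
  apply: tends_sum => m1 _; apply: tends_sum => m2 _; apply: tends_sum => m3 _.
  exact: (tendsM (tendsM (tendsM (cbe m1) (cbe m2)) (cbe m3))
    (@tends_cst R[i] (rho ^+ (m2 + 2 * m3)))).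
have := tendsB (tendsM Slim (@tends_cst R[i] (3^-1))) diff0.
rewrite subr0; apply: tends_near; near=> N.
have -> : S N = 3 * \sum_(0 <= n < N) T N n by exact: ml_triple_identity.
rewrite mulrAC mulfV ?pnatr_eq0 // mul1r.
by rewrite opprB addrC subrK.
Unshelve. all: by end_near.
Qed.

End TripleLimit.

(** * Unconditional sums over the nonzero integers *)

Section EvenSums.
Variable R : realType.

Definition nzpos (j : nat) : nzint := exist _ (Posz j.+1) isT.
Definition nzneg (j : nat) : nzint := exist _ (Negz j) isT.

Lemma nzint_cases (i : nzint) :
  i = nzpos (absz (val i)).-1 \/ i = nzneg (absz (val i)).-1.
Proof.
case: i => -[[|j]|j] // p; [left|right]; exact/val_inj.
Qed.

Lemma sum_even_fset (f : nzint -> R[i]) (g : nat -> R[i]) (X : {fset nzint}) N :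
  (forall i, f i = g (absz (val i)).-1) ->
  (forall i, i \in X -> (absz (val i) <= N)%N) ->
  \sum_(i : X) f (val i) =
    \sum_(0 <= j < N) ((nzpos j \in X)%:R + (nzneg j \in X)%:R) * g j.
Proof.
move=> fg XN.
rewrite -(big_seq_fsetE _ _ xpredT f) /=.
have -> : \sum_(i <- X) f i =
    \sum_(i <- [seq nzpos j | j <- index_iota 0 N] ++ [seq nzneg j | j <- index_iota 0 N] | i \in X) f i.
  rewrite -[RHS]big_filter; apply: perm_big; apply: uniq_perm.
  - exact: fset_uniq.
  - rewrite filter_uniq // cat_uniq !map_inj_uniq ?iota_uniq //=.
    + by rewrite andbT; apply/hasPn => _ /mapP[j _ ->]; apply/mapP => -[k _].
    + by move=> j k [->].
    + by move=> j k [->].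
  move=> i; rewrite mem_filter; have [iX|//] := boolP (i \in _); rewrite /= mem_cat.
  have jN : ((absz (val i)).-1 \in index_iota 0 N).
    rewrite mem_index_iota /=; have := XN i iX.
    by case: (i) => -[[|j]|j].
  by case: (nzint_cases i) => ->; rewrite (map_f _ jN) ?orbT.
rewrite big_cat !big_map /= [X in X + _]big_mkcond [X in _ + X]big_mkcond -big_split /=.
apply: eq_bigr => j _; rewrite !fg /= mulrDl.
by do 2 case: (_ \in _); rewrite ?mul1r ?mul0r.
Qed.

(** A finite set containing all integers up to [N] in absolute value gives the
    [N]-th partial sum twice, plus terms of larger index weighted by [0], [1]
    or [2], which add up to at most [2 c / N]. *)
Lemma has_sum_even (f : nzint -> R[i]) (g : nat -> R[i]) (c : R) S :
  (forall i, f i = g (absz (val i)).-1) ->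
  (forall j, normc (g j) <= c * j.+1%:R ^- 2) ->
  tends (fun N => \sum_(0 <= j < N) g j) S ->
  has_sum f (2 * S).
Proof.
move=> fg gc gS.
have c0 : 0 <= c.
  have := le_trans (normc_ge0 _) (gc 0%N).
  by rewrite pmulr_lge0 // invr_gt0 exprn_gt0.
have totF := @summability.totally_filter nzint.
apply/cvgrPdist_le => eps; rewrite ltcE /= => /andP[/eqP Ie Re0].
set e := complex.Re eps in Re0.
have epsE : eps = e%:C by rewrite (complexE eps) Ie mulr0 addr0.
near \oo => N.
have N0 : (0 < N)%N by near: N; exact: nbhs_infty_gt.
have Ne : c * N%:R^-1 <= e / 4.
  rewrite ler_pdivrMr ?ltr0n // mulrC -ler_pdivrMr; last lra.
  near: N; exact: nbhs_infty_ger.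
have SN : normc (\sum_(0 <= j < N) g j - S) <= e / 4.
  by near: N; move/tendscP: gS; apply; lra.
pose A : {fset nzint} := 
  seq_fset tt ([seq nzpos j | j <- index_iota 0 N] ++ [seq nzneg j | j <- index_iota 0 N]).
exists A => // X /= /fsubsetP AX.
rewrite epsE norm_normc lecR normc_distC.
pose N1 := (\sum_(i <- X) absz (val i) + N)%N.
have XN i : i \in X -> (absz (val i) <= N1)%N.
  move=> iX; rewrite /N1 (big_rem i) //=; lia.
have NN1 : (N <= N1)%N by rewrite /N1 leq_addl.
rewrite /summability.partial_sum (sum_even_fset fg XN) (big_cat_nat (leq0n N) NN1) /=.
have inA j : (j < N)%N -> (nzpos j \in X) /\ (nzneg j \in X).
  move=> jN; split; apply: AX; rewrite seq_fsetE mem_cat map_f ?orbT ?mem_index_iota //.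
have -> : \sum_(0 <= j < N) ((nzpos j \in X)%:R + (nzneg j \in X)%:R) * g j =
    2 * \sum_(0 <= j < N) g j.
  rewrite mulr_sumr !big_nat; apply: eq_bigr => j jN.
  by have [-> ->] := inA j jN; rewrite /=; ring.
set T := \sum_(N <= j < N1) _.
have hT : normc T <= 2 * (e / 4).
  apply: le_trans (normc_sum _ _ _) _.
  apply: le_trans (_ : \sum_(N <= j < N1) 2 * (c * j.+1%:R ^- 2) <= _).
    apply: ler_sum => j _; rewrite normcM ler_pM ?normc_ge0 // -natrD normc_nat ler_nat.
    by do 2 case: (_ \in _).
  rewrite -mulr_sumr ler_wpM2l // -mulr_sumr; apply: (le_trans _ Ne).
  by rewrite ler_wpM2l // sum_inv_sqr_le.
have -> : 2 * \sum_(0 <= j < N) g j + T - 2 * S = 2 * (\sum_(0 <= j < N) g j - S) + T by ring.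
apply: le_trans (normcD _ _) _; rewrite normcM normc_nat; lra.
Unshelve. all: by end_near.
Qed.

End EvenSums.

(** * The hyperbolic form of the terms *)

Section Hyperbolic.
Variable R : realType.
Local Notation rho := (@rho R).
Local Notation pi_ := ((pi : R)%:C).
Implicit Types (z t I s : R[i]).

Lemma ccoshN z : ccosh (- z) = ccosh z.
Proof. by rewrite /ccosh opprK addrC. Qed.

Lemma csinhN z : csinh (- z) = - csinh z.
Proof. by rewrite /csinh opprK -mulNr opprB. Qed.

Lemma ccosh0 : ccosh (0 : R[i]) = 1.
Proof. by rewrite /ccosh oppr0 cexp0; field. Qed.

Lemma ccosh_genE t (y : R) :
  ccosh_gen t y = t / 2 * ccosh (t * (y - 1 / 2)%:C) / csinh (t / 2).
Proof.
rewrite /ccosh_gen /ccosh /csinh.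
have q0 := cexp_neq0 (t / 2).
have h2 : (1 / 2 : R)%:C = 1 / 2 :> R[i] by rewrite fmorph_div rmorph1 rmorph_nat.
have -> : t * y%:C = t / 2 + t * (y - 1 / 2)%:C by rewrite rmorphB /= h2; field.
have -> : t * (1 - y)%:C = t / 2 - t * (y - 1 / 2)%:C.
  by rewrite !rmorphB /= h2 rmorph1; field.
have -> : cexp t = cexp (t / 2) * cexp (t / 2) by rewrite -cexpD; congr cexp; field.
rewrite !cexpD -mulrDr (cexpN (t / 2)).
move: (cexp (t / 2)) q0 => q q0; move: (cexp _ + _) => X.
have -> : q * q - 1 = q * (q - q^-1) by rewrite mulrBr mulfV.
rewrite !invfM invrK; move: (q - q^-1)^-1 => d.
by field.
Qed.

(** From [1 + rho + rho^2 = 0].  When [cexp I] is a sign, a hyperbolic function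
    takes therefore the same value at [I * rho] as at [I * rho ^+ 2], up to a
    sign, and the two distinct sines of the residue merge into a square. *)
Lemma rho_opp I : I * rho = - (I + I * rho ^+ 2).
Proof.
apply/eqP; rewrite -subr_eq0 opprK.
have -> : I * rho + (I + I * rho ^+ 2) = I * (1 + rho + rho ^+ 2) by ring.
by rewrite rho_sum mulr0.
Qed.

Lemma csinh_rho I s : cexp I = s -> s * s = 1 ->
  csinh (I * rho) = - (s * csinh (I * rho ^+ 2)).
Proof.
move=> Is ss; have sV : s^-1 = s.
  by rewrite -[LHS]mul1r -ss mulfK // -Is cexp_neq0.
rewrite rho_opp csinhN /csinh opprD !cexpD (cexpN I) Is sV.
by rewrite -mulrBr mulrA.
Qed.

Lemma ccosh_rho I s : cexp I = s -> s * s = 1 ->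
  ccosh (I * rho) = s * ccosh (I * rho ^+ 2).
Proof.
move=> Is ss; have sV : s^-1 = s.
  by rewrite -[LHS]mul1r -ss mulfK // -Is cexp_neq0.
rewrite rho_opp ccoshN /ccosh opprD !cexpD (cexpN I) Is sV.
by rewrite -mulrDr mulrA.
Qed.

Lemma signz_sqr (m : int) : (-1) ^ m * (-1) ^ m = 1 :> R[i].
Proof.
case: m => n; first by rewrite -exprnP -expr2 sqrr_sign.
by rewrite NegzE -exprnN -invfM -expr2 sqrr_sign invr1.
Qed.

Lemma pi_i (x : R) : x%:C * pi_ * 'i%C = 0 +i* (pi * x) :> R[i].
Proof. by rewrite -rmorphM; simpc; rewrite mulrC. Qed.

Lemma cexp_int_pi (m : int) : cexp (m%:~R * pi_ * 'i%C) = (-1) ^ m.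
Proof.
have h (n : nat) : cexp (n%:R * pi_ * 'i%C) = (-1) ^+ n.
  by rewrite -cexp_pi -cexpMn -mulrA -[pi_]mul1r -[1](rmorph1 (real_complex R)) pi_i mulr1.
case: m => n; first exact: h.
by rewrite NegzE mulrNz !mulNr cexpN -pmulrn h exprnN.
Qed.

Definition main_term k (y : R) (m : int) : R[i] :=
  (-1) ^ m * (cos (2 * m%:~R * pi * y))%:C
    / m%:~R ^+ (6 * k + 4)
  * (ccosh (2 * m%:~R * pi_ * 'i%C / rho * (y - 1 / 2)%:C)
     * ccosh (2 * m%:~R * pi_ * 'i%C * rho * (y - 1 / 2)%:C)
     / csinh (m%:~R * pi_ * 'i%C / rho) ^+ 2).

Lemma main_term_opp k y m : main_term k y (- m) = main_term k y m.
Proof.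
rewrite /main_term !mulrNz !(mulrN, mulNr) cosN !ccoshN csinhN sqrrN.
have -> : (- m%:~R) ^+ (6 * k + 4) = m%:~R ^+ (6 * k + 4) :> R[i].
  by rewrite (_ : 6 * k + 4 = 2 * (3 * k + 2))%N ?exprM ?sqrrN //; lia.
have -> : (-1) ^ (- m) = (-1) ^ m :> R[i].
  by apply: (mulIf (_ : (-1) ^ m != 0)); rewrite ?expfz_neq0 ?oppr_eq0 ?oner_eq0 //
    -expfzDr ?oppr_eq0 ?oner_eq0 // addNr expr0z signz_sqr.
by [].
Qed.

Lemma main_term_pos k y n :
  main_term k y (Posz n.+1) = (-1) ^+ k / (2 * pi_ ^+ 2) * triple_term k y n.
Proof.
set x : R[i] := n.+1%:R; set I := x * pi_ * 'i%C.
have x0 : x != 0 by rewrite pnatr_eq0.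
have p0 : pi_ != 0 :> R[i].
  by rewrite (inj_eq (@complexI R) _ 0) gt_eqF ?pi_gt0.
have tI : 0 +i* (2 * pi * n.+1%:R) = 2 * I.
  rewrite /I /x -(rmorph_nat (real_complex R) n.+1) pi_i imM; congr (_ +i* _); ring.
rewrite /main_term /triple_term !ccosh_genE tI /cos_coef -[(Posz n.+1)%:~R]/(n.+1%:R) -/x.
rewrite -[(Posz n.+1)%:~R]/(n.+1%:R).
have sI : cexp I = (-1) ^+ n.+1 by exact: (cexp_int_pi (Posz n.+1)).
have ss : (-1) ^+ n.+1 * (-1) ^+ n.+1 = 1 :> R[i] by rewrite -expr2 sqrr_sign.
rewrite -[(-1) ^ Posz n.+1]/((-1) ^+ n.+1).
have -> : 2 * I * rho ^+ 2 / 2 = I * rho ^+ 2 by field.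
have -> : 2 * I * rho / 2 = I * rho by field.
rewrite (csinh_rho sI ss) rhoV -/I.
have -> : 2 * x * pi_ * 'i%C = 2 * I by rewrite /I; ring.
have -> : 2 * n.+1%:R * pi * y = 2 * pi * n.+1%:R * y by ring.
have r3 := @rho3 R.
have M3 : (-1) ^+ k * (-1) ^+ (3 * k + 3) = -1 :> R[i].
  by rewrite -exprD -signr_odd (_ : odd _ = true) ?expr1 //; lia.
have II : I * I = - (x * pi_) ^+ 2.
  by rewrite /I mulrACA -expr2 -[_ * 'i%C]expr2 sqr_i mulrN1.
have sV : ((-1) ^+ n.+1)^-1 = (-1) ^+ n.+1 :> R[i] by rewrite invr_sign.
rewrite (exprNn (x ^- 2)) exprVn -exprM.
rewrite (_ : 2 * (3 * k + 3) = 6 * k + 4 + 2)%N; last by lia.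
rewrite -/x (exprD x (6 * k + 4)) invrN (invfM ((-1) ^+ n.+1)) sV -(exprVn (csinh _)).
have X0 : x ^+ (6 * k + 4) != 0 by rewrite expf_neq0.
move: (ccosh _) (ccosh _) (csinh _)^-1 (cos _)%:C => C C' d a.
move: ((-1) ^+ n.+1) ((-1) ^+ k) ((-1) ^+ (3 * k + 3)) (x ^+ (6 * k + 4)) M3 X0.
move=> s e1 e2 X M3 X0.
transitivity ((e1 * e2) * (I * I) * rho ^+ 3 * (s * a * C * C' * d ^+ 2) /
    (pi_ ^+ 2 * X * x ^+ 2)).
  rewrite M3 II r3; move: (x) x0 (pi_) p0 => z z0 p p0.
  by field; rewrite p0 z0 X0.
move: (I) (x) x0 (pi_) p0 => J z z0 p p0.
by field; rewrite p0 z0 X0.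
Qed.

Lemma has_sum_main_term (B : nat -> {poly R}) k y : is_bernoulli B -> 0 <= y <= 1 ->
  has_sum (fun n : nzint => main_term k y (val n))
    (4 * (-1) ^+ k * (2 * pi_) ^+ (6 * k + 4) / 3 * bernoulli_triple_sum B k y).
Proof.
move=> hB y01; set K := (-1) ^+ k / (2 * pi_ ^+ 2) : R[i].
have p0 : pi_ != 0 :> R[i].
  by rewrite (inj_eq (@complexI R) _ 0) gt_eqF ?pi_gt0.
have -> : 4 * (-1) ^+ k * (2 * pi_) ^+ (6 * k + 4) / 3 * bernoulli_triple_sum B k y =
  2 * (K * ((2 * pi_) ^+ (6 * k + 6) * bernoulli_triple_sum B k y / 3)).
  rewrite (_ : 6 * k + 6 = 6 * k + 4 + 2)%N; last by lia.
  rewrite (exprD _ (6 * k + 4)) /K.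
  move: (_ ^+ (6 * k + 4)) (_ ^+ k) (bernoulli_triple_sum _ _ _) => X s T.
  by move: (pi_) p0 => p p0; field.
apply: (@has_sum_even R _ (fun j => K * triple_term k y j) (normc K * 50)).
- move=> i; rewrite -main_term_pos; case: i => -[[|j]|j] //= _.
  by rewrite NegzE main_term_opp.
- move=> j; rewrite (normcM K) -mulrA; apply: ler_wpM2l; first exact: normc_ge0.
  exact: triple_term_bound.
have := tendsM (@tends_cst R[i] K) (@tends_triple_sum R B k y hB y01).
by apply: tends_near; near=> N; rewrite mulr_sumr.
Unshelve. all: by end_near.
Qed.

(** At [y = 0] the two hyperbolic cosines are equal up to the sign [(-1) ^ m]. *)
Lemma main_term_0 k m :
  main_term k 0 m = ccoth (m%:~R * pi_ * 'i%C / rho) ^+ 2 / m%:~R ^+ (6 * k + 4).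
Proof.
rewrite /main_term mulr0 cos0 mulr1.
have h2 : (0 - 1 / 2 : R)%:C = - (1 / 2) :> R[i].
  by rewrite sub0r rmorphN fmorph_div rmorph1 rmorph_nat.
rewrite h2; set I := m%:~R * pi_ * 'i%C.
have -> : 2 * m%:~R * pi_ * 'i%C / rho * - (1 / 2) = - (I / rho) by rewrite /I; field; exact: rho_neq0.
have -> : 2 * m%:~R * pi_ * 'i%C * rho * - (1 / 2) = - (I * rho) by rewrite /I; field.
have ss := signz_sqr m.
have ce : ccosh (I * rho) = (-1) ^ m * ccosh (I / rho).
  by rewrite rhoV; apply: ccosh_rho => //; exact: cexp_int_pi.
rewrite !ccoshN ce /ccoth (expr_div_n (ccosh _)).
move: (ccosh _) (csinh _ ^+ 2)^-1 (m%:~R ^+ _)^-1 => C d X.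
transitivity (((-1) ^ m * (-1) ^ m) * (C ^+ 2 * d * X)); first by ring.
by rewrite ss mul1r.
Qed.

Lemma main_term_half k m :
  main_term k (1 / 2) m =
  1 / (csinh (m%:~R * pi_ * 'i%C / rho) ^+ 2 * m%:~R ^+ (6 * k + 4)).
Proof.
have cE : (cos (2 * m%:~R * pi * (1 / 2)))%:C = (-1) ^ m :> R[i].
  have E : 0 +i* (2 * m%:~R * pi * (1 / 2)) = m%:~R * pi_ * 'i%C :> R[i].
    rewrite -(rmorph_int (real_complex R)) pi_i; congr (_ +i* _).
    by field.
  have := cexp_imD (2 * m%:~R * pi * (1 / 2) : R).
  rewrite E cexpN cexp_int_pi rmorphM rmorph_nat.
  have -> : ((-1) ^ m)^-1 = (-1) ^ m :> R[i].
    have s0 : (-1) ^ m != 0 :> R[i] by rewrite expfz_neq0 // oppr_eq0 oner_eq0.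
    by apply: (mulIf s0); rewrite mulVf // signz_sqr.
  move=> h; have two : (2 : R[i]) != 0 by rewrite pnatr_eq0.
  by apply: (mulfI two); rewrite -h; ring.
rewrite /main_term cE subrr !mulr0 ccosh0 signz_sqr.
move: (csinh _ ^+ 2) (m%:~R ^+ _) => s X.
by rewrite !mul1r invfM mulrC.
Qed.

End Hyperbolic.

Theorem corollary6p4 (R : realType) (B : nat -> {poly R})
    (hB : is_bernoulli B) (k : nat) :
  let pi_ : R[i] := (pi : R)%:C in
  let c : R[i] := 4 * (-1) ^+ k * (2 * pi_) ^+ (6 * k + 4) / 3 in
  [/\ forall y : R, 0 <= y <= 1 ->
        has_sum
          (fun n : nzint => let m : int := val n in
             (-1) ^ m * (cos (2 * m%:~R * pi * y))%:C
               / m%:~R ^+ (6 * k + 4)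
             * (ccosh (2 * m%:~R * pi_ * 'i%C / rho * (y - 1 / 2)%:C)
                * ccosh (2 * m%:~R * pi_ * 'i%C * rho * (y - 1 / 2)%:C)
                / csinh (m%:~R * pi_ * 'i%C / rho) ^+ 2))
          (c * bernoulli_triple_sum B k y),
      has_sum
        (fun n : nzint => let m : int := val n in
           ccoth (m%:~R * pi_ * 'i%C / rho) ^+ 2 / m%:~R ^+ (6 * k + 4))
        (c * bernoulli_triple_sum B k 0)
    & has_sum
        (fun n : nzint => let m : int := val n in
           1 / (csinh (m%:~R * pi_ * 'i%C / rho) ^+ 2
                * m%:~R ^+ (6 * k + 4)))
        (c * bernoulli_triple_sum B k (1 / 2))].
Proof.
move=> pi_ c; split=> [y y01||].
- exact: has_sum_main_term.
- have -> : (fun n : nzint => let m : int := val n in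
      ccoth (m%:~R * pi_ * 'i%C / rho) ^+ 2 / m%:~R ^+ (6 * k + 4)) =
      fun n => main_term k 0 (val n).
    by apply/funext => n; rewrite main_term_0.
  by apply: has_sum_main_term; rewrite ?lexx ?ler01.
- have -> : (fun n : nzint => let m : int := val n in
      1 / (csinh (m%:~R * pi_ * 'i%C / rho) ^+ 2 * m%:~R ^+ (6 * k + 4))) =
      fun n => main_term k (1 / 2) (val n).
    by apply/funext => n; rewrite main_term_half.
  by apply: has_sum_main_term => //; lra.
Qed.
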